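(* Assume (A1), and assume (C2) holds for some $0<q<2$. Then $$\sup_{x\in[0,1]^d}|g_n(x)-Eg_n(x)|=O_{a.s.}\!\left[\frac{(\log n)^{1/q}}{(nh_n)^{d/2}}\right].$$
   Context: Fix an integer $d\ge1$. For $x=(x_1,\dots,x_d)\in\mathbb{R}^d$ let $\|x\|=\max_{1\le k\le d}|x_k|$; for $i,j\in\mathbb{Z}^d$ let $|i-j|=\max_{1\le l\le d}|i_l-j_l|$, and $|k|=|k-0|$. Let $(\varepsilon_i)_{i\in\mathbb{Z}^d}$ be a strictly stationary real random field on a probability space $(\Omega,\mathcal F,\mathbb P)$ with $E\varepsilon_0=0$. Strict stationarity means: for all $k\in\mathbb{Z}^d$, $n\ge1$ and $i_1,\dots,i_n\in\mathbb{Z}^d$, the vectors $(\varepsilon_{i_1},\dots,\varepsilon_{i_n})$ and $(\varepsilon_{i_1+k},\dots,\varepsilon_{i_n+k})$ have the same law. Let $g:[0,1]^d\to\mathbb{R}$ and $\Lambda_n=\{1,\dots,n\}^d$, and set $Y_i=g(i/n)+\varepsilon_i$ for $i\in\Lambda_n$. Let $K$ be a probability density on $\mathbb{R}^d$ and $(h_n)_{n\ge1}$ positive numbers with $h_n\to0$ and $nh_n\to\infty$. For $x\in[0,1]^d$ define $$g_n(x)=\frac{\sum_{i\in\Lambda_n}Y_i\,K\big((x-i/n)/h_n\big)}{\sum_{i\in\Lambda_n}K\big((x-i/n)/h_n\big)}.$$ Assumption (A1): $K$ is symmetric and nonnegative, and supported in $[-1,1]^d$. There is $\eta>0$ with $|K(x)-K(y)|\le\eta\|x-y\|$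 for all $x,y\in[-1,1]^d$, and there are constants $c,C>0$ with $c\le K(x)\le C$ for all $x\in[-1,1]^d$. Notation $O_{a.s.}$: for real random variables $Z_n$ and positive numbers $v_n$, $Z_n=O_{a.s.}[v_n]$ means there exists a deterministic $\lambda>0$ with $\limsup_{n\to\infty}|Z_n|/v_n\le\lambda$ almost surely. Dependence notation: $i<_{lex}j$ for distinct $i,j\in\mathbb{Z}^d$ means either $i_1<j_1$, or for some $p\in\{2,\dots,d\}$ one has $i_p<j_p$ and $i_q=j_q$ for $1\le q<p$. Set $V_i^1=\{j\in\mathbb{Z}^d: j<_{lex}i\}$ and, for integers $m\ge2$, $V_i^m=V_i^1\cap\{j:|i-j|\ge m\}$. For $\Gamma\subset\mathbb{Z}^d$ let $\mathcal F_\Gamma=\sigma(\varepsilon_j: j\in\Gamma)$. For $k\in V_0^1$ (so $|k|\ge1$) put $E_{|k|}(\varepsilon_0)=E(\varepsilon_0\mid\mathcal F_{V_0^{|k|}})$. Orlicz notation: for $\beta>0$ let $\psi_\beta(x)=\exp((x+\xi_\beta)^\beta)-\exp(\xi_\beta^\beta)$ for $x\ge0$, where $\xi_\beta=((1-\beta)/\beta)^{1/\beta}$ if $0<\beta<1$ and $\xi_\beta=0$ otherwise. For a real random variable $Z$, $\|Z\|_{\psi_\beta}=\inf\{c>0: E[\psi_\beta(|Z|/c)]\le1\}$, and $L_{\psi_\beta}$ is the space of $Z$ with $\|Z\|_{\psi_\beta}<\infty$. For $0<q<2$ let $\beta(q)=2q/(2-q)$. Condition (C2) (for a given $0<q<2$):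 $\varepsilon_0\in L_{\psi_{\beta(q)}}$ and $\sum_{k\in V_0^1}\big\|\sqrt{|\varepsilon_kE_{|k|}(\varepsilon_0)|}\big\|_{\psi_{\beta(q)}}^2<\infty$. *)

(* Defs.v *)
From HB Require Import structures.
From mathcomp Require Import all_boot all_order all_algebra.
From mathcomp Require Import all_classical all_reals all_analysis.
Set Implicit Arguments. Unset Strict Implicit. Unset Printing Implicit Defensive.
Import Order.TTheory GRing.Theory Num.Theory.
Import numFieldNormedType.Exports.
Local Open Scope classical_set_scope.
Local Open Scope ring_scope.

Definition zdist (d : nat) (i j : 'I_d -> int) : nat :=
  \max_(l < d) absz (i l - j l).

Definition zzero (d : nat) : 'I_d -> int := fun _ => 0%R.

Definition lexlt (d : nat) (i j : 'I_d -> int) : Prop :=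
  exists p : 'I_d, (i p < j p)%R /\ forall q : 'I_d, (q < p)%N -> i q = j q.

(* V_i^m = {j : j <_lex i, |i - j| >= m}  (for m = 1 the distance
   condition is automatic, since j <_lex i forces j <> i) *)
Definition Vset (d m : nat) (i : 'I_d -> int) : set ('I_d -> int) :=
  [set j | lexlt j i /\ (m <= zdist i j)%N].

Section field.
Context {R : realType} {dT : measure_display} {T : measurableType dT}.

Definition strictly_stationary (d : nat) (P : probability T R)
    (eps : ('I_d -> int) -> T -> R) : Prop :=
  forall (k : 'I_d -> int) (n : nat) (s : n.-tuple ('I_d -> int))
         (B : set (n.-tuple R)), measurable B ->
    P ((fun w => [tuple eps (tnth s j) w | j < n]) @^-1` B) =
    P ((fun w => [tuple eps (fun l => tnth s j l + k l) w | j < n]) @^-1` B).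

Definition FGamma (d : nat) (eps : ('I_d -> int) -> T -> R)
    (G : set ('I_d -> int)) : set (set T) :=
  <<s \bigcup_(j in G) preimage_set_system setT (eps j) measurable >>.

Definition cond_exp_version (P : probability T R) (X : T -> R)
    (G : set (set T)) (Z : T -> R) : Prop :=
  [/\ (forall B : set R, measurable B -> G (Z @^-1` B)),
      P.-integrable setT (EFin \o Z) &
      forall A, G A -> (\int[P]_(w in A) (Z w)%:E = \int[P]_(w in A) (X w)%:E)%E].

Definition xi_beta (beta : R) : R :=
  if beta < 1 then ((1 - beta) / beta) `^ (beta^-1) else 0.

Definition psi_beta (beta x : R) : R :=
  expR ((x + xi_beta beta) `^ beta) - expR (xi_beta beta `^ beta).

Definition orlicz_norm (P : probability T R) (beta : R) (Z : T -> R) : \bar R :=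
  ereal_inf [set c%:E | c in [set c : R | 0 < c /\
     (\int[P]_w (psi_beta beta (`|Z w| / c))%:E <= 1)%E]].

Definition in_Lpsi (P : probability T R) (beta : R) (Z : T -> R) : Prop :=
  (orlicz_norm P beta Z < +oo)%E.

End field.

Definition beta_q {R : realType} (q : R) : R := 2 * q / (2 - q).

Definition condC2 {R : realType} {dT : measure_display} {T : measurableType dT}
    (d : nat) (P : probability T R) (eps : ('I_d -> int) -> T -> R) (q : R) : Prop :=
  in_Lpsi P (beta_q q) (eps (@zzero d)) /\
  exists Em : nat -> T -> R,
    (forall m, (1 <= m)%N ->
       cond_exp_version P (eps (@zzero d)) (FGamma eps (Vset m (@zzero d))) (Em m)) /\
    (\esum_(k in Vset 1 (@zzero d))
        (orlicz_norm P (beta_q q)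
           (fun w => Num.sqrt `|eps k w * Em (zdist k (@zzero d)) w|)%R *
         orlicz_norm P (beta_q q)
           (fun w => Num.sqrt `|eps k w * Em (zdist k (@zzero d)) w|)%R) < +oo)%E.

Definition supnorm {R : realType} (d : nat) (x : 'I_d -> R) : R :=
  \big[Num.max/0]_(l < d) `|x l|.

Definition cube01 {R : realType} (d : nat) : set ('I_d -> R) :=
  [set x | forall l, 0 <= x l <= 1].

Definition cube11 {R : realType} (d : nat) : set ('I_d -> R) :=
  [set x | forall l, -1 <= x l <= 1].

(* iterated Lebesgue integral over R^d (equal to the integral w.r.t. the
   d-dimensional Lebesgue measure for nonnegative measurable integrands, by
   Tonelli) *)
Fixpoint lebint {R : realType} (d : nat) : (('I_d -> R) -> \bar R) -> \bar R :=
  match d return (('I_d -> R) -> \bar R) -> \bar R with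
  | 0 => fun f => f (fun _ => 0)
  | d'.+1 => fun f =>
      (\int[@lebesgue_measure R]_t
         lebint (fun y : 'I_d' -> R =>
           f (fun i : 'I_d'.+1 => if unlift ord0 i is Some j then y j else t)))%E
  end.

Definition prob_density {R : realType} (d : nat) (K : ('I_d -> R) -> R) : Prop :=
  [/\ measurable_fun setT (fun t : d.-tuple R => K (fun l => tnth t l)),
      (forall x, 0 <= K x) &
      lebint (fun x => (K x)%:E) = 1%E].

Definition assumptionA1 {R : realType} (d : nat) (K : ('I_d -> R) -> R) : Prop :=
  [/\ (forall x, K (fun l => - x l) = K x),
      (forall x, 0 <= K x),
      (forall x, 1 < supnorm x -> K x = 0),
      (exists2 eta : R, 0 < eta & forall x y, x \in @cube11 R d -> y \in @cube11 R d ->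
          `|K x - K y| <= eta * supnorm (fun l => x l - y l)) &
      (exists c C : R, [/\ 0 < c, 0 < C &
          forall x, x \in @cube11 R d -> c <= K x <= C])].

(* grid point i/n for i in Lambda_n = {1..n}^d, encoded by f : 'I_d -> 'I_n
   via i_l = f l + 1 *)
Definition gridpt {R : realType} (d n : nat) (f : {ffun 'I_d -> 'I_n}) : 'I_d -> R :=
  fun l => (f l).+1%:R / n%:R.

Definition gridix (d n : nat) (f : {ffun 'I_d -> 'I_n}) : 'I_d -> int :=
  fun l => ((f l).+1)%:Z.

Definition gn {R : realType} {T : Type} (d : nat) (K : ('I_d -> R) -> R)
    (g : ('I_d -> R) -> R) (eps : ('I_d -> int) -> T -> R) (h : nat -> R)
    (n : nat) (x : 'I_d -> R) (w : T) : R :=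
  (\sum_(f : {ffun 'I_d -> 'I_n})
      (g (gridpt f) + eps (gridix f) w) * K (fun l => (x l - gridpt f l) / h n)) /
  (\sum_(f : {ffun 'I_d -> 'I_n}) K (fun l => (x l - gridpt f l) / h n)).

Definition sup_dev {R : realType} {dT : measure_display} {T : measurableType dT}
    (d : nat) (P : probability T R) (K : ('I_d -> R) -> R)
    (g : ('I_d -> R) -> R) (eps : ('I_d -> int) -> T -> R) (h : nat -> R)
    (n : nat) (w : T) : \bar R :=
  ereal_sup [set (`|gn K g eps h n x w - fine ('E_P[gn K g eps h n x])|)%:E
            | x in @cube01 R d].

Definition O_as {R : realType} {dT : measure_display} {T : measurableType dT}
    (P : probability T R) (Z : nat -> T -> \bar R) (v : nat -> R) : Prop :=
  exists2 lam : R, 0 < lam &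
    {ae P, forall w, (limn_esup (fun n => Z n w * ((v n)^-1)%:E) <= lam%:E)%E}.

(* Main.v *)
(* The numerator of g_n - E g_n is a weighted sum S of the errors over the about (n h_n)^d grid points
   within distance h_n of x, with weights of order (n h_n)^-d. Following Dedecker, one adds the points
   in lexicographic order: a second order Taylor expansion of S^(2m) leaves a cross term
   E[eps_i S'^(2m-1)] that involves earlier points only, and removing those points one by one bounds it
   by the conditional expectations E_|k|(eps_0). This gives E S^(2m) <= (C m alpha_m #points)^m, where
   the moment bound alpha_m is O(m^(2/beta)) under the Orlicz condition and 1 + 2/beta(q) = 2/q.
   Markov's inequality with m about ln n makes the deviation at one point larger than a multiple of the
   rate with probability at most n^-kappa, for any prescribed kappa. K jumps at the boundary of its
   support, so the cube is not covered by balls alone but by polynomially many cells on which moreover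
   the set of active grid points is constant; Borel-Cantelli concludes. *)

Require Import Defs.
From HB Require Import structures.
From mathcomp Require Import all_boot all_order all_algebra.
From mathcomp Require Import all_classical all_reals all_analysis.
From mathcomp Require Import measurable_realfun.
From mathcomp Require Import ring lra zify.
Import Order.TTheory GRing.Theory Num.Theory.
Import numFieldNormedType.Exports.
Set Implicit Arguments.
Unset Strict Implicit.
Unset Printing Implicit Defensive.
Local Open Scope classical_set_scope.
Local Open Scope ring_scope.

(** * Elementary inequalities for powers of real numbers *)

Section RealInequalities.
Context {R : realType}.
Implicit Types s t u M a b : R.

(** The induction on the number of points tolerates no constant factor per step: from the bound x^m
    without the last point one must reach (x + y)^m, which leaves room only for about m y x^(m-1), y
    being the share of one point. So in the Taylor remainder (s + t)^(2m-2) is split with a constant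
    e^2, independent of m, in front of s^(2m-2); the huge factor falls on the power of t alone and
    is harmless once there are more than m points. Fewer points are treated by the triangle
    inequality. (C2) controls only the products eps_k E_|k|(eps_0), not the conditional expectation
    by itself. Removing the point k produces such a product, because the increment of a power of the
    sum carries a factor eps_k. Moving x inside a cell costs a Lipschitz constant times the largest
    error. That error is kept below a power of n by a second moment bound, and the power is
    compensated by a finer mesh. As n h_n >= 1 eventually, a polynomial mesh suffices, whatever the
    speed of h_n. *)

Lemma norm_subrX_le (p : nat) u s M : `|u| <= M -> `|s| <= M ->
  `|u ^+ p.+1 - s ^+ p.+1| <= p.+1%:R * (`|u - s| * M ^+ p).
Proof.
move=> uM sM; have M0 : 0 <= M by apply: le_trans sM.
elim: p => [|p IH]; first by rewrite !expr1 expr0 mulr1 mul1r.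
have -> : u ^+ p.+2 - s ^+ p.+2 = u * (u ^+ p.+1 - s ^+ p.+1) + s ^+ p.+1 * (u - s).
  by rewrite !exprS; ring.
rewrite (le_trans (ler_normD _ _))// -(natr1 p.+1) mulrDl mul1r lerD//.
- rewrite normrM (le_trans (ler_pM _ _ uM IH))//.
  by rewrite [M ^+ p.+1]exprS le_eqVlt; apply/orP; left; apply/eqP; ring.
- by rewrite normrM mulrC ler_wpM2l// normrX lerXn2r// nnegrE.
Qed.

(** Peeling one factor [u] off the remainder leaves [p.+2%:R * (s ^+ p.+1 * (u - s) ^+ 2)], so the
    constant grows by [p.+2] at each step; the square is a convenient majorant. *)
Lemma norm_taylor2_le (p : nat) u s M : `|u| <= M -> `|s| <= M ->
  `|u ^+ p.+2 - s ^+ p.+2 - p.+2%:R * s ^+ p.+1 * (u - s)| <=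
  p.+2%:R ^+ 2 * ((u - s) ^+ 2 * M ^+ p).
Proof.
move=> uM sM; have M0 : 0 <= M by apply: le_trans sM.
elim: p => [|p IH].
  have -> : u ^+ 2 - s ^+ 2 - 2%:R * s ^+ 1 * (u - s) = (u - s) ^+ 2 by ring.
  by rewrite expr0 mulr1 ger0_norm ?sqr_ge0// ler_peMl ?sqr_ge0//; lra.
have -> : u ^+ p.+3 - s ^+ p.+3 - p.+3%:R * s ^+ p.+2 * (u - s) =
    u * (u ^+ p.+2 - s ^+ p.+2 - p.+2%:R * s ^+ p.+1 * (u - s)) +
    p.+2%:R * (s ^+ p.+1 * (u - s) ^+ 2).
  have -> : p.+3%:R = p.+2%:R + 1 :> R by rewrite natr1.
  by rewrite !exprS; ring.
rewrite (le_trans (ler_normD _ _))//.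
apply: (@le_trans _ _ (p.+2%:R ^+ 2 * ((u - s) ^+ 2 * M ^+ p.+1) +
    p.+2%:R * ((u - s) ^+ 2 * M ^+ p.+1))).
  apply: lerD.
    rewrite normrM (le_trans (ler_pM _ _ uM IH))//.
    by rewrite [M ^+ p.+1]exprS le_eqVlt; apply/orP; left; apply/eqP; ring.
  rewrite normrM ger0_norm ?ler0n// ler_wpM2l// normrM mulrC.
  rewrite [`|_ ^+ 2|]ger0_norm ?sqr_ge0// ler_wpM2l ?sqr_ge0//.
  by rewrite normrX lerXn2r// nnegrE.
rewrite -mulrDl; apply: ler_wpM2r; first by rewrite mulr_ge0 ?sqr_ge0 ?exprn_ge0.
have : (0 : R) <= p.+2%:R by [].
by rewrite -(natr1 p.+2); nra.
Qed.

(** Trades the maximum, with which the two previous bounds are applied, for a sum whose integral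
    splits. *)
Lemma maxr_exp_le (n : nat) u s :
  (Num.max `|u| `|s|) ^+ n.*2 <= u ^+ n.*2 + s ^+ n.*2.
Proof.
have e (x : R) : `|x| ^+ n.*2 = x ^+ n.*2.
  by rewrite -normrX ger0_norm// -mul2n exprM exprn_ge0// sqr_ge0.
have p (x : R) : 0 <= x ^+ n.*2 by rewrite -e exprn_ge0.
by rewrite /Num.max; case: ifP => _; rewrite e ?lerDr ?lerDl.
Qed.

Lemma exprn_double_ge0 (n : nat) u : 0 <= u ^+ n.*2.
Proof. by rewrite -mul2n exprM exprn_ge0// sqr_ge0. Qed.

Lemma norm_subrX_le_even (n : nat) u s :
  `|u ^+ n.*2.+1 - s ^+ n.*2.+1| <=
  n.*2.+1%:R * (`|u - s| * (u ^+ n.*2 + s ^+ n.*2)).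
Proof.
rewrite (le_trans (@norm_subrX_le _ u s (Num.max `|u| `|s|) _ _)) ?le_max ?lexx ?orbT//.
by rewrite !ler_wpM2l// maxr_exp_le.
Qed.

(** The linear term is kept exact: its expectation is small by cancellation, its absolute value is
    not. Only the quadratic remainder is bounded pointwise. *)
Lemma taylor2_even_le (n : nat) s t :
  (s + t) ^+ n.+1.*2 <= s ^+ n.+1.*2 + n.+1.*2%:R * (t * s ^+ n.*2.+1) +
    n.+1.*2%:R ^+ 2 * (t ^+ 2 * ((s + t) ^+ n.*2 + s ^+ n.*2)).
Proof.
have := @norm_taylor2_le n.*2 (s + t) s (Num.max `|s + t| `|s|).
rewrite !le_max !lexx orbT => /(_ isT isT) H.
have {}H := le_trans (ler_norm _) H.
rewrite [s + t - s]addrAC subrr add0r in H.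
have K : t ^+ 2 * Num.max `|s + t| `|s| ^+ n.*2 <= t ^+ 2 * ((s + t) ^+ n.*2 + s ^+ n.*2).
  by rewrite ler_wpM2l ?sqr_ge0// maxr_exp_le.
have {}K := ler_wpM2l (exprn_ge0 2 (ler0n R n.*2.+2)) K.
rewrite doubleS.
by move: (le_trans H K); rewrite [_ * s ^+ _ * t]mulrAC -[_ * t * _]mulrA; lra.
Qed.

(** Young's inequality with both weights, of sum 1, replaced by 1; this is the factor 2 lost in
    [Rintegral_mulX_le]. *)
Lemma mulrX_le_addX (n : nat) a b : 0 <= a -> 0 <= b ->
  a * b ^+ n <= a ^+ n.+1 + b ^+ n.+1.
Proof.
move=> a0 b0; have [ab|/ltW ba] := leP a b.
  by apply: (@le_trans _ _ (b ^+ n.+1)); rewrite ?lerDr ?exprn_ge0// exprS ler_wpM2r// exprn_ge0.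
apply: (@le_trans _ _ (a ^+ n.+1)); rewrite ?lerDl ?exprn_ge0// exprS ler_wpM2l//.
by rewrite lerXn2r// nnegrE.
Qed.

(* Splits on whether [|t| <= |s| / n.+1]. *)
Lemma exprD_even_le (n : nat) s t :
  (s + t) ^+ n.*2 <= expR 2 * s ^+ n.*2 + n.+2%:R ^+ n.*2 * t ^+ n.*2.
Proof.
have e (x : R) : `|x| ^+ n.*2 = x ^+ n.*2 by rewrite -normrX ger0_norm// exprn_double_ge0.
have m0 : (0 : R) < n.+1%:R by [].
rewrite -e; have [ts|st] := leP `|t| (n.+1%:R^-1 * `|s|).
  apply: (@le_trans _ _ (((1 + n.+1%:R^-1) * `|s|) ^+ n.*2)).
    rewrite lerXn2r// ?nnegrE ?mulr_ge0 ?addr_ge0 ?invr_ge0// (le_trans (ler_normD _ _))//.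
    by rewrite mulrDl mul1r lerD2l.
  rewrite exprMn e -[leLHS]addr0 lerD ?mulr_ge0 ?exprn_double_ge0//.
  rewrite ler_wpM2r ?exprn_double_ge0//.
  (* The power is at most exp(2n / (n+1)) <= exp 2; a split by convexity would cost a power of 2
     growing with [n]. *)
  apply: (@le_trans _ _ (expR n.+1%:R^-1 ^+ n.*2)).
    by rewrite lerXn2r ?nnegrE ?addr_ge0 ?invr_ge0 ?expR_ge0 ?expR_ge1Dx.
  rewrite -expRM_natl ler_expR -muln2 natrM.
  rewrite ler_pdivrMr// mulrC ler_wpM2l//.
  by rewrite ler_nat.
apply: (@le_trans _ _ ((n.+2%:R * `|t|) ^+ n.*2)).
  rewrite lerXn2r ?nnegrE ?mulr_ge0// (le_trans (ler_normD _ _))//.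
  rewrite -(natr1 n.+1) mulrDl mul1r lerD2r.
  by move: st; rewrite mulrC ltr_pdivrMr// mulrC => /ltW.
by rewrite exprMn e lerDr mulr_ge0 ?expR_ge0 ?exprn_double_ge0.
Qed.

(** The power mean inequality up to a factor [size s], obtained by comparing every term with the
    largest one. The exponent is positive, so [M = 0] serves the empty list. *)
Lemma sum_expr_even_le (I : eqType) (s : seq I) (f : I -> R) (n : nat) :
  (\sum_(i <- s) f i) ^+ n.+1.*2 <= (size s)%:R ^+ n.+1.*2 * \sum_(i <- s) f i ^+ n.+1.*2.
Proof.
have e (x : R) : `|x| ^+ n.+1.*2 = x ^+ n.+1.*2 by rewrite -normrX ger0_norm// exprn_double_ge0.
have p0 (r : seq I) : 0 <= \sum_(i <- r) f i ^+ n.+1.*2.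
  by rewrite big_seq sumr_ge0// => i _; exact: exprn_double_ge0.
have [M [M0 Ms MS]] : exists M, [/\ 0 <= M, (forall i, i \in s -> `|f i| <= M) &
    M ^+ n.+1.*2 <= \sum_(i <- s) f i ^+ n.+1.*2].
  elim: s => [|x s [M [M0 Ms MS]]]; first by exists 0; rewrite big_nil doubleS expr0n.
  exists (Num.max `|f x| M); split; first by rewrite le_max M0 orbT.
    by move=> i; rewrite inE le_max => /orP[/eqP->|/Ms ->]; rewrite ?lexx ?orbT.
  rewrite big_cons /Num.max; case: ifP => _.
    by rewrite (le_trans MS)// lerDr exprn_double_ge0.
  by rewrite e lerDl p0.
rewrite -e; apply: (@le_trans _ _ (((size s)%:R * M) ^+ n.+1.*2)); last first.
  by rewrite exprMn ler_wpM2l// exprn_ge0.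
rewrite lerXn2r ?nnegrE ?mulr_ge0// (le_trans (ler_norm_sum _ _ _))//.
elim: s Ms {MS p0} => [|x s IH] Ms /=; first by rewrite big_nil mul0r.
rewrite big_cons -natr1 mulrDl mul1r addrC lerD ?Ms ?inE ?eqxx// IH// => i si.
by apply: Ms; rewrite inE si orbT.
Qed.

End RealInequalities.

(** * Random variables with moments of all orders *)

Section AllMoments.
Context {R : realType} {dT : measure_display} {T : measurableType dT}.
Variable P : probability T R.
Implicit Types X Y Z : T -> R.

(** A class closed under sums, products and powers, so that integrability of a polynomial in the
    errors follows from closure alone. *)
Definition all_moments X : Prop :=
  measurable_fun setT X /\ forall n, P.-integrable setT (EFin \o (fun w => X w ^+ n)).

Lemma integrable_norm_le X Y : measurable_fun setT X ->
  P.-integrable setT (EFin \o Y) -> (forall w, `|X w| <= Y w) ->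
  P.-integrable setT (EFin \o X).
Proof.
move=> mX iY XY; apply: (le_integrable _ _ _ iY) => //; first exact/measurable_EFinP.
move=> w _ /=; rewrite lee_fin (le_trans (XY w))// ger0_norm//.
exact: le_trans (XY w).
Qed.

Lemma all_moments_even X : measurable_fun setT X ->
  (forall n, P.-integrable setT (EFin \o (fun w => X w ^+ n.*2))) -> all_moments X.
Proof.
move=> mX iX; split=> // n.
apply: (@integrable_norm_le _ (fun w => 1 + X w ^+ n.*2)).
- exact: measurable_funX.
- have := integrableD measurableT (finite_measure_integrable_cst P 1 measurableT) (iX n).
  by apply: eq_integrable.
- move=> w; rewrite -mul2n mulnC exprM.
  rewrite -[X w ^+ n ^+ 2]real_normK ?num_real//.
  by have := normr_ge0 (X w ^+ n); nra.
Qed.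

Lemma all_moments_integrable X : all_moments X -> P.-integrable setT (EFin \o X).
Proof. by move=> [_ /(_ 1%N)]. Qed.

Lemma all_moments_cst c : all_moments (fun=> c).
Proof.
by split=> [|n]; [exact: measurable_cst|exact: finite_measure_integrable_cst].
Qed.

Lemma all_momentsX n X : all_moments X -> all_moments (fun w => X w ^+ n).
Proof.
move=> [mX iX]; split=> [|k]; first exact: measurable_funX.
by under eq_fun do rewrite -exprM.
Qed.

Lemma all_momentsZ c X : all_moments X -> all_moments (fun w => c * X w).
Proof.
move=> [mX iX]; split=> [|n]; first exact: measurable_funM.
have := integrableZl measurableT (c ^+ n) (iX n).
by apply: eq_integrable => // w _ /=; rewrite exprMn EFinM.
Qed.

Lemma all_momentsD X Y : all_moments X -> all_moments Y ->
  all_moments (fun w => X w + Y w).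
Proof.
move=> [mX iX] [mY iY]; apply: all_moments_even => [|n]; first exact: measurable_funD.
apply: (@integrable_norm_le _ (fun w => expR 2 * X w ^+ n.*2 + n.+2%:R ^+ n.*2 * Y w ^+ n.*2)).
- by apply: measurable_funX; exact: measurable_funD.
- have := integrableD measurableT (integrableZl measurableT (expR 2) (iX n.*2))
    (integrableZl measurableT (n.+2%:R ^+ n.*2) (iY n.*2)).
  by apply: eq_integrable.
- by move=> w; rewrite ger0_norm ?exprn_double_ge0 ?exprD_even_le.
Qed.

Lemma all_momentsM X Y : all_moments X -> all_moments Y ->
  all_moments (fun w => X w * Y w).
Proof.
move=> [mX iX] [mY iY]; apply: all_moments_even => [|n]; first exact: measurable_funM.
apply: (@integrable_norm_le _ (fun w => X w ^+ n.*2.*2 + Y w ^+ n.*2.*2)).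
- by apply: measurable_funX; exact: measurable_funM.
- have := integrableD measurableT (iX n.*2.*2) (iY n.*2.*2).
  by apply: eq_integrable.
- move=> w; rewrite ger0_norm ?exprn_double_ge0 // exprMn -!(muln2 n.*2) !exprM.
  have := exprn_double_ge0 n (X w); have := exprn_double_ge0 n (Y w).
  by have := sqr_ge0 (X w ^+ n.*2 - Y w ^+ n.*2); nra.
Qed.

Lemma all_moments_sum (I : eqType) (s : seq I) (f : I -> T -> R) :
  (forall i, i \in s -> all_moments (f i)) -> all_moments (fun w => \sum_(i <- s) f i w).
Proof.
elim: s => [|i s IH] H.
  by under eq_fun do rewrite big_nil; exact: all_moments_cst.
under eq_fun do rewrite big_cons; apply: all_momentsD; first exact/H/mem_head.
by apply: IH => j js; apply: H; rewrite inE js orbT.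
Qed.

Lemma all_moments_norm X : all_moments X -> all_moments (fun w => `|X w|).
Proof.
move=> [mX iX]; apply: all_moments_even => [|n]; first exact: measurableT_comp.
under eq_fun do rewrite -normrX ger0_norm ?exprn_double_ge0//; exact: iX.
Qed.

Lemma Rintegral_le X Y : all_moments X -> all_moments Y -> (forall w, X w <= Y w) ->
  \int[P]_w X w <= \int[P]_w Y w.
Proof. by move=> /all_moments_integrable iX /all_moments_integrable iY XY; exact: le_Rintegral. Qed.

Lemma all_moments_RintegralD X Y : all_moments X -> all_moments Y ->
  \int[P]_w (X w + Y w) = \int[P]_w X w + \int[P]_w Y w.
Proof. by move=> /all_moments_integrable iX /all_moments_integrable iY; exact: RintegralD. Qed.

Lemma all_moments_RintegralZ c X : all_moments X ->
  \int[P]_w (c * X w) = c * \int[P]_w X w.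
Proof. by move=> /all_moments_integrable iX; exact: RintegralZl. Qed.

Lemma all_moments_Rintegral_sum (I : eqType) (s : seq I) (f : I -> T -> R) :
  (forall i, i \in s -> all_moments (f i)) ->
  \int[P]_w (\sum_(i <- s) f i w) = \sum_(i <- s) \int[P]_w f i w.
Proof.
elim: s => [|i s IH] H.
  by under eq_Rintegral do rewrite big_nil; rewrite big_nil Rintegral_cst// mul0r.
have Hs j : j \in s -> all_moments (f j) by move=> js; apply: H; rewrite inE js orbT.
under eq_Rintegral do rewrite big_cons.
by rewrite all_moments_RintegralD ?big_cons ?IH//; [exact/H/mem_head|exact: all_moments_sum].
Qed.

(* Hölder's inequality for the exponents n.+1 and n.+1 / n, up to a factor 2. *)
Lemma Rintegral_mulX_le Z Y (al x : R) n : all_moments Z -> all_moments Y ->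
  (forall w, 0 <= Y w) -> 0 <= al -> 0 < x ->
  \int[P]_w (`|Z w| ^+ n.+1) <= al ^+ n.+1 -> \int[P]_w (Y w ^+ n.+1) <= x ^+ n.+1 ->
  \int[P]_w (`|Z w| * Y w ^+ n) <= 2 * al * x ^+ n.
Proof.
move=> aZ aY Y0 al0 x0 HZ HY.
(* [al] may be [0] and cannot serve as a normalization; the bound is proved for every positive
   [b >= al], and [b] tends to [al] at the end. *)
have H b : 0 < b -> al <= b -> \int[P]_w (`|Z w| * Y w ^+ n) <= 2 * b * x ^+ n.
  move=> b0 alb.
  have aZn := all_momentsX n.+1 (all_moments_norm aZ).
  have aYn := all_momentsX n.+1 aY.
  have := @Rintegral_le (fun w => `|Z w| * Y w ^+ n)
    (fun w => b * x ^+ n * b ^- n.+1 * `|Z w| ^+ n.+1 + b * x ^+ n * x ^- n.+1 * Y w ^+ n.+1).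
  rewrite all_moments_RintegralD; [|exact: all_momentsZ..].
  rewrite !all_moments_RintegralZ//.
  move=> /(_ _ _ _)/le_trans; apply.
  - by apply: all_momentsM; [exact: all_moments_norm|exact: all_momentsX].
  - by apply: all_momentsD; apply: all_momentsZ.
  - move=> w.
    have K := mulrX_le_addX n (divr_ge0 (normr_ge0 (Z w)) (ltW b0)) (divr_ge0 (Y0 w) (ltW x0)).
    have {K} := ler_wpM2l (ltW (mulr_gt0 b0 (exprn_gt0 n x0))) K.
    rewrite !expr_div_n mulrDr => K.
    have bx : (b != 0) && (x != 0) by rewrite !gt_eqF.
    have -> : `|Z w| * Y w ^+ n = b * x ^+ n * (`|Z w| / b * (Y w ^+ n / x ^+ n)).
      by field; case/andP: bx => ? ?; rewrite expf_neq0.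
    by rewrite (le_trans K)// lerD// -!mulrA [_ / _]mulrC.
  - have bx : 0 <= b * x ^+ n by rewrite mulr_ge0 ?exprn_ge0 ?ltW.
    have -> : 2 * b * x ^+ n = b * x ^+ n * 1 + b * x ^+ n * 1 by ring.
    rewrite -!mulrA ![b * (x ^+ n * _)]mulrA lerD// ler_wpM2l//.
      rewrite mulrC ler_pdivrMr ?exprn_gt0// mul1r (le_trans HZ)// lerXn2r// nnegrE ltW//.
    by rewrite mulrC ler_pdivrMr ?exprn_gt0// mul1r.
apply/ler_addgt0Pr => e e0.
have xn : 0 < x ^+ n by rewrite exprn_gt0.
have d0 : 0 < e / (2 * x ^+ n) by rewrite divr_gt0// mulr_gt0.
have := H (al + e / (2 * x ^+ n)); rewrite ltr_wpDl// lerDl ltW// => /(_ isT isT)/le_trans.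
apply; rewrite le_eqVlt; apply/orP; left; apply/eqP; field.
by rewrite gt_eqF.
Qed.

End AllMoments.

(** * Approximation of a real number by finitely many values *)

Section Rounding.
Context {R : realType}.

Let lower n (i : nat) : R := (i%:R - n.+1%:R ^+ 2) / n.+1%:R.
Let cell n i (y : R) : bool := lower n i <= y < lower n i + n.+1%:R^-1.

(** Rounds down to the mesh [1 / n.+1] on the interval from [- n.+1] to [n.+1] and gives [0]
    elsewhere. Composed with a function measurable for a sub-sigma-algebra, it is a simple function
    for that sub-sigma-algebra, at most [|y| + 1] in absolute value. *)
Definition rounding n (y : R) : R := \sum_(i < 2 * n.+1 ^ 2) lower n i * (cell n i y)%:R.

Let rounding_cell n (i : 'I_(2 * n.+1 ^ 2)) y : cell n i y -> rounding n y = lower n i.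
Proof.
move=> yi; rewrite /rounding (bigD1 i)//= yi mulr1 big1 ?addr0// => j ji.
case yj : (cell n j y); last by rewrite mulr0.
suff /eqP : (j : nat) = i by rewrite val_eqE (negbTE ji).
have a0 : (0 : R) < n.+1%:R by [].
have e k : lower n k + n.+1%:R^-1 = lower n k.+1.
  by rewrite /lower -(natr1 k); field; rewrite gt_eqF.
move: yi yj; rewrite /cell !e => /andP[i1 i2] /andP[j1 j2].
have lt_lower k l : lower n k < lower n l -> (k < l)%N.
  by rewrite /lower ltr_pM2r ?invr_gt0// ltrD2r ltr_nat.
have := lt_lower _ _ (le_lt_trans i1 j2); have := lt_lower _ _ (le_lt_trans j1 i2).
by lia.
Qed.

Lemma rounding_bound n y : `|rounding n y| <= `|y| + 1.
Proof.
have [[i yi]|no] := pselect (exists i : 'I_(2 * n.+1 ^ 2), cell n i y).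
  rewrite (rounding_cell yi); move: yi => /andP[].
  have : (n.+1%:R^-1 : R) <= 1 by rewrite invf_le1// ler1n.
  move: (lower n i) (n.+1%:R^-1 : R) => l a a1 ly yl.
  have := ler_norm y; have := ler_norm (- y); rewrite normrN.
  by rewrite ler_norml; lra.
rewrite /rounding big1 ?normr0 ?addr_ge0// => i _.
by case yi : (cell n i y); [case: no; exists i|rewrite mulr0].
Qed.

Lemma rounding_close n y : `|y| < n.+1%:R -> `|y - rounding n y| <= n.+1%:R^-1.
Proof.
have a0 : (0 : R) < n.+1%:R by [].
rewrite ltr_norml => /andP[y1 y2].
pose i := Num.truncn (n.+1%:R * y + n.+1%:R ^+ 2).
have p0 : 0 <= n.+1%:R * y + n.+1%:R ^+ 2 by rewrite expr2 -mulrDr mulr_ge0//; lra.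
have /andP[i1 i2] := truncn_itv p0.
have ilt : (i < 2 * n.+1 ^ 2)%N.
  rewrite -(ltr_nat R) (le_lt_trans i1)// natrM natrX.
  by have : n.+1%:R * y < n.+1%:R * n.+1%:R; [rewrite ltr_pM2l|rewrite !expr2; lra].
have yi : cell n (Ordinal ilt) y.
  rewrite /cell /lower /=; apply/andP; split.
    by rewrite ler_pdivrMr// lerBlDr mulrC.
  rewrite -[X in _ + X]mul1r -mulrDl ltr_pdivlMr//.
  by move: i2; rewrite -/i -natr1 mulrC; lra.
rewrite (rounding_cell yi); move: yi => /andP[].
by move: (lower n _) (n.+1%:R^-1 : R) => l a ly yl; rewrite ger0_norm; lra.
Qed.

Lemma rounding_cvg y : rounding ^~ y @ \oo --> y.
Proof.
apply/cvgrPdist_le => e e0.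
near=> n; rewrite (le_trans (@rounding_close n y _))//.
  near: n; exists (Num.truncn `|y|).+1 => // n /= yn.
  by rewrite (lt_trans (truncnS_gt _))// ltr_nat ltnS (leq_trans _ yn).
by rewrite ltW//; near: n; exact: (near_infty_natSinv_lt (PosNum e0)).
Unshelve. all: by end_near. Qed.

Lemma rounding_simple n : exists (c : 'I_(2 * n.+1 ^ 2) -> R) (B : 'I_(2 * n.+1 ^ 2) -> set R),
  (forall i, measurable (B i)) /\ forall y, rounding n y = \sum_i c i * \1_(B i) y.
Proof.
exists (lower n), (fun i => [set` `[lower n i, lower n i + n.+1%:R^-1[ ]); split=> [i|y].
  exact: measurable_itv.
by apply: eq_bigr => i _; rewrite indicE mem_setE in_itv.
Qed.

End Rounding.

(** * Conditional expectation in integrated form, equality in law *)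

Section ConditionalExpectation.
Context {R : realType} {dT : measure_display} {T : measurableType dT}.
Variable P : probability T R.
Implicit Types (X Z W D : T -> R) (G : set (set T)).

(** Holds for indicators of sets of [G], hence for the roundings of [W], whose level sets are
    preimages under [W]; dominated convergence with [|D| (|W| + 1)] passes to [W]. *)
Lemma Rintegral_mul_eq0 G D W :
  P.-integrable setT (EFin \o D) -> (forall A, G A -> measurable A) ->
  (forall A, G A -> \int[P]_(w in A) D w = 0) ->
  (forall B, measurable B -> G (W @^-1` B)) ->
  P.-integrable setT (EFin \o (fun w => D w * W w)) ->
  \int[P]_w (D w * W w) = 0.
Proof.
move=> iD Gm GD GW iDW.
have mD : measurable_fun setT D by exact/measurable_EFinP/(measurable_int P).
have cvgDW : \int[P]_w (D w * rounding n (W w)) @[n --> \oo] --> \int[P]_w (D w * W w).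
  have mW : measurable_fun setT W by move=> _ B mB; rewrite setTI; exact/Gm/GW.
  have mrd n : measurable_fun setT (fun w => rounding n (W w)).
    have [c [B [mB rE]]] := @rounding_simple R n.
    under eq_fun do rewrite rE; apply: measurable_sum => i; apply: measurable_funM => //.
    exact: (measurableT_comp (measurable_indic (mB i))).
  have ig : P.-integrable setT (EFin \o (fun w => `|D w| * (`|W w| + 1))).
    have := integrableD measurableT (integrable_norm iDW) (integrable_norm iD).
    by apply: eq_integrable => // w _ /=; rewrite -EFinD mulrDr mulr1 normrM.
  have [] := @dominated_convergence _ _ _ P setT measurableT
    (fun n w => (D w * rounding n (W w))%:E) (fun w => (D w * W w)%:E)
    (EFin \o (fun w => `|D w| * (`|W w| + 1))) _ _ _ ig _.
  - by move=> n; apply/measurable_EFinP; exact: measurable_funM.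
  - by apply/measurable_EFinP; exact: measurable_funM.
  - by apply: aeW => w _; apply: cvg_EFin; [exact: nearW|apply: cvgMr; exact: rounding_cvg].
  - by apply: aeW => w n _ /=; rewrite lee_fin normrM ler_wpM2l// rounding_bound.
  - move=> _ _; rewrite -[X in _ --> X -> _]fineK ?integrable_fin_num//.
    exact: fine_cvg.
have e0 n : \int[P]_w (D w * rounding n (W w)) = 0.
  have [c [B [mB rE]]] := @rounding_simple R n.
  have DB i : (fun w => D w * (c i * \1_(B i) (W w))) = (fun w => c i * (D \_ (W @^-1` B i)) w).
    apply/funext => w; rewrite patchE indicE.
    have -> : (w \in W @^-1` B i) = (W w \in B i) by apply/idP/idP; rewrite !inE.
    by case: ifP => _; rewrite /= ?mulr1 ?mulr0 // mulrC.
  have iB i : P.-integrable setT (EFin \o (D \_ (W @^-1` B i))).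
    have mA := Gm _ (GW _ (mB i)).
    rewrite -restrict_EFin; apply/(integrable_mkcond _ mA).
    by apply: integrableS iD.
  have iB' i : P.-integrable setT (EFin \o (fun w => D w * (c i * \1_(B i) (W w)))).
    by rewrite DB; have := integrableZl measurableT (c i) (iB i); apply: eq_integrable.
  under eq_Rintegral do rewrite rE big_distrr/=.
  rewrite /Rintegral; under eq_integral do rewrite -sumEFin.
  rewrite integral_sum// big1// => i _.
  rewrite -[X in X = _]fineK; last exact: (integrable_fin_num measurableT (iB' i)).
  rewrite -/(Rintegral P setT _) DB RintegralZl// -Rintegral_mkcond.
  by rewrite GD ?mulr0//; exact: (GW _ (mB i)).
move: cvgDW; rewrite (_ : (fun n => _) = fun=> 0); last exact/funext/e0.
by move=> /(cvg_lim (@Rhausdorff R)); rewrite lim_cst.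
Qed.

(** [X - Z] integrates to zero over every set of [G], so the previous lemma applies to it. *)
Lemma cond_exp_mul G X Z W :
  cond_exp_version P X G Z -> (forall A, G A -> measurable A) ->
  (forall B, measurable B -> G (W @^-1` B)) ->
  P.-integrable setT (EFin \o X) ->
  P.-integrable setT (EFin \o (fun w => X w * W w)) ->
  P.-integrable setT (EFin \o (fun w => Z w * W w)) ->
  \int[P]_w (X w * W w) = \int[P]_w (Z w * W w).
Proof.
move=> [GZ iZ XZ] Gm GW iX iXW iZW.
have iD : P.-integrable setT (EFin \o (fun w => X w - Z w)).
  by have := integrableB measurableT iX iZ; apply: eq_integrable.
have e w : (X w - Z w) * W w = X w * W w - Z w * W w by rewrite mulrBl.
apply/eqP; rewrite -subr_eq0 -RintegralB//; apply/eqP.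
under eq_Rintegral do rewrite -e.
apply: (@Rintegral_mul_eq0 G) => //.
  move=> A GA; have mA := Gm _ GA.
  rewrite RintegralB//; [|exact: integrableS iX|exact: integrableS iZ].
  by rewrite /Rintegral XZ// subrr.
by under eq_fun do rewrite e; have := integrableB measurableT iXW iZW; apply: eq_integrable.
Qed.

Definition same_law d' (U : measurableType d') (V V' : T -> U) : Prop :=
  forall B, measurable B -> P (V @^-1` B) = P (V' @^-1` B).

Lemma same_law_ge0_integral d' (U : measurableType d') (V V' : T -> U) (F : U -> \bar R) :
  measurable_fun setT V -> measurable_fun setT V' -> same_law V V' ->
  measurable_fun setT F -> (forall u, 0 <= F u)%E ->
  (\int[P]_w F (V w) = \int[P]_w F (V' w))%E.
Proof.
move=> mV mV' VV' mF F0.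
have e (Z : T -> U) (mZ : measurable_fun setT Z) : (\int[P]_w F (Z w) = \int[pushforward P Z]_y F y)%E.
  by rewrite (ge0_integral_pushforward mZ)// => y _; exact: F0.
rewrite !e//; apply: eq_measure_integral => A mA _; exact: VV'.
Qed.

Lemma same_law_Rintegral d' (U : measurableType d') (V V' : T -> U) (F : U -> R) :
  measurable_fun setT V -> measurable_fun setT V' -> same_law V V' ->
  measurable_fun setT F ->
  \int[P]_w F (V w) = \int[P]_w F (V' w).
Proof.
move=> mV mV' VV' mF; rewrite /Rintegral; congr fine.
have mFE : measurable_fun setT (EFin \o F) by exact/measurable_EFinP.
have e (Z : T -> U) : (\int[P]_w (F (Z w))%:E =
    \int[P]_w ((EFin \o F)^\+ (Z w)) - \int[P]_w ((EFin \o F)^\- (Z w)))%E.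
  by rewrite (integralE _ _ ((EFin \o F) \o Z)) funepos_comp funeneg_comp.
have ep := same_law_ge0_integral mV mV' VV' (measurable_funepos mFE) (funepos_ge0 _).
have en := same_law_ge0_integral mV mV' VV' (measurable_funeneg mFE) (funeneg_ge0 _).
exact: etrans (etrans (e V) (congr2 (fun x y => x - y)%E ep en)) (esym (e V')).
Qed.

Lemma same_law_integrable d' (U : measurableType d') (V V' : T -> U) (F : U -> R) :
  measurable_fun setT V -> measurable_fun setT V' -> same_law V V' ->
  measurable_fun setT F -> P.-integrable setT (EFin \o (fun w => F (V w))) ->
  P.-integrable setT (EFin \o (fun w => F (V' w))).
Proof.
move=> mV mV' VV' mF /integrableP[_ FV]; apply/integrableP; split.
  by apply/measurable_EFinP; exact: measurableT_comp.
rewrite -(same_law_ge0_integral mV mV' VV' (F := fun u => `|(F u)%:E|%E))//.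
by apply: measurableT_comp => //; exact/measurable_EFinP.
Qed.

End ConditionalExpectation.

(** * Lexicographic order on the lattice *)

Section LexicographicOrder.
Context {d : nat}.
Implicit Types i j k : 'I_d -> int.

Lemma lexlt_trans j i k : lexlt i j -> lexlt j k -> lexlt i k.
Proof.
move=> [p [ijp ijq]] [p' [jkp jkq]]; have [pp'|p'p|pp'] := ltngtP p p'.
- exists p; split=> [|q qp]; first by rewrite -(jkq _ pp').
  by rewrite ijq// jkq// (ltn_trans qp).
- exists p'; split=> [|q qp]; first by rewrite (ijq _ p'p).
  by rewrite ijq ?jkq// (ltn_trans qp).
- move/val_inj : pp' => pp'; subst p'; exists p; split=> [|q qp]; first exact: lt_trans jkp.
  by rewrite ijq// jkq.
Qed.

Lemma lexlt_total i j : i <> j -> lexlt i j \/ lexlt j i.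
Proof.
move=> ij; have [p0 ijp0] : exists p, i p != j p.
  apply: contrapT => H; apply: ij; apply/funext => p; apply/eqP.
  by apply: contrapT => /negP ijp; apply: H; exists p.
case: (@arg_minnP _ p0 (fun p => i p != j p) (@nat_of_ord d) ijp0) => p ijp pmin.
have eq_lt (q : 'I_d) : (q < p)%N -> i q = j q.
  by move=> qp; apply/eqP; apply: contraTT qp => /pmin; rewrite -leqNgt.
move: ijp; rewrite neq_lt => /orP[lt|lt]; [left|right]; exists p; split=> // q qp.
by rewrite eq_lt.
Qed.

(** Selects the point to be added last, so that all the others precede it. *)
Lemma exists_lexmax (s : seq ('I_d -> int)) : s != [::] ->
  exists2 i, i \in s & forall j, j \in s -> j <> i -> lexlt j i.
Proof.
elim: s => // x s IH _; have [->|/IH[i si imax]] := eqVneq s [::].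
  by exists x; rewrite ?mem_head// => j; rewrite inE => /eqP.
have [xi|/eqP/lexlt_total[xi|ix]] := eqVneq x i.
- exists i; first by rewrite inE si orbT.
  by move=> j; rewrite inE => /orP[/eqP->|]; [rewrite xi|exact: imax].
- exists i; first by rewrite inE si orbT.
  by move=> j; rewrite inE => /orP[/eqP->|]; [|exact: imax].
- exists x; first exact: mem_head.
  move=> j; rewrite inE => /orP[/eqP->//|js] _.
  have [->//|/eqP ji] := eqVneq j i.
  by apply: lexlt_trans ix; exact: imax.
Qed.

(** Moves [i] to the origin, where (C2) is formulated. *)
Lemma Vset_sub i j : lexlt j i -> Vset 1 (@zzero d) (fun l => j l - i l).
Proof.
move=> [p [jip jiq]]; split.
  exists p; split; first by rewrite /zzero subr_lt0.
  by move=> q qp; rewrite /zzero jiq// subrr.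
rewrite (@leq_trans (absz (zzero p - (j p - i p))%R))//.
  by rewrite absz_gt0 /zzero sub0r oppr_eq0 subr_eq0 lt_eqF.
exact: (@leq_bigmax _ (fun l => absz (zzero l - (j l - i l))%R)).
Qed.

Lemma zdistC i j : zdist i j = zdist j i.
Proof. by apply: eq_bigr => l _; rewrite -abszN opprB. Qed.

End LexicographicOrder.

(** * Consequences of strict stationarity *)

Section Stationarity.
Context {R : realType} {dT : measure_display} {T : measurableType dT} {d : nat}.
Variables (P : probability T R) (eps : ('I_d -> int) -> T -> R).
Hypothesis measurable_eps : forall i, measurable_fun setT (eps i).
Hypothesis stationary_eps : strictly_stationary P eps.

Definition eps_tuple n (s : n.-tuple ('I_d -> int)) : T -> n.-tuple R :=
  fun w => [tuple eps (tnth s j) w | j < n].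

Definition shift_tuple n (k : 'I_d -> int) (s : n.-tuple ('I_d -> int)) :
  n.-tuple ('I_d -> int) := [tuple (fun l => tnth s j l + k l) | j < n].

Lemma measurable_eps_tuple n (s : n.-tuple _) : measurable_fun setT (eps_tuple s).
Proof.
apply/measurable_fun_tnthP => j.
rewrite (_ : _ \o _ = eps (tnth s j))//; apply/funext => w.
by rewrite /= /eps_tuple tnth_mktuple.
Qed.

Lemma same_law_shift n k (s : n.-tuple _) :
  same_law P (eps_tuple s) (eps_tuple (shift_tuple k s)).
Proof.
move=> B mB; rewrite (_ : eps_tuple (shift_tuple k s) =
  fun w => [tuple eps (fun l => tnth s j l + k l) w | j < n]); first exact: stationary_eps.
by apply/funext => w; apply: eq_mktuple => j; rewrite tnth_mktuple.
Qed.

(** Both sides integrate the same function [F] of a finite tuple of errors, with [eps i] at its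
    head; the tuple is shifted by [-i], while the weights stay attached to the original points. *)
Lemma stationary_sum (a : ('I_d -> int) -> R) s i p :
  \int[P]_w (eps i w * (\sum_(j <- s) a j * eps j w) ^+ p) =
  \int[P]_w (eps (@zzero d) w * (\sum_(j <- s) a j * eps (fun l => j l - i l) w) ^+ p).
Proof.
pose F (v : (size s).+1.-tuple R) : R :=
  tnth v ord0 * (\sum_(l < size s) a (tnth (in_tuple s) l) * tnth v (lift ord0 l)) ^+ p.
have mF : measurable_fun setT F.
  apply: measurable_funM; first exact: measurable_tnth.
  apply: measurable_funX; apply: measurable_sum => l.
  by apply: measurable_funM => //; exact: measurable_tnth.
have := same_law_Rintegral (measurable_eps_tuple _) (measurable_eps_tuple _)
  (@same_law_shift _ (fun l => - i l) [tuple of i :: in_tuple s]) mF.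
congr (_ = _); apply: eq_Rintegral => w _; rewrite /F.
  rewrite tnth_mktuple tnth0; congr (_ * _ ^+ p).
  by rewrite [RHS]big_tnth; apply: eq_bigr => l _; rewrite tnth_mktuple tnthS.
rewrite !tnth_mktuple tnth0; congr (_ * _ ^+ p).
  by congr (eps _ w); apply/funext => l; rewrite /zzero subrr.
rewrite [RHS]big_tnth; apply: eq_bigr => l _; rewrite !tnth_mktuple tnthS.
by congr (_ * eps _ w).
Qed.

Lemma same_law_eps i : same_law P (eps (@zzero d)) (eps i).
Proof.
move=> B mB; pose B' : set (1.-tuple R) := (@tnth 1 R ^~ ord0) @^-1` B.
have mB' : measurable B' by rewrite -[B']setTI; exact: measurable_tnth.
have := @same_law_shift _ i [tuple @zzero d] B' mB'.
have e (t : 1.-tuple ('I_d -> int)) : eps_tuple t @^-1` B' = eps (tnth t ord0) @^-1` B.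
  by apply/seteqP; split=> w; rewrite /B' /preimage/= /eps_tuple tnth_mktuple.
rewrite !e tnth_mktuple !tnth0 => ->; congr (P (eps _ @^-1` B)).
by apply/funext => l; rewrite /zzero add0r.
Qed.

Lemma stationary_Rintegral (F : R -> R) i : measurable_fun setT F ->
  \int[P]_w F (eps i w) = \int[P]_w F (eps (@zzero d) w).
Proof. by move=> mF; apply/esym/same_law_Rintegral => //; exact: same_law_eps. Qed.

Lemma stationary_all_moments i : all_moments P (eps (@zzero d)) -> all_moments P (eps i).
Proof.
move=> [_ H]; split=> // n.
apply: (@same_law_integrable _ _ _ P _ _ (eps (@zzero d)) (eps i) (fun x => x ^+ n)) => //.
exact: same_law_eps.
Qed.

Lemma FGamma_measurable G A : FGamma eps G A -> measurable A.
Proof.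
apply: smallest_sub; first exact: sigma_algebra_measurable.
by move=> _ [j _ [B mB <-]]; exact: measurable_eps.
Qed.

(* Measurability for the sub-sigma-algebra is measurability on the type [g_sigma_algebraType]. *)
Lemma FGamma_measurable_diff G s s' (a : ('I_d -> int) -> R) p :
  (forall k, k \in s -> G k) -> (forall k, k \in s' -> G k) ->
  forall B, measurable B -> FGamma eps G ((fun w =>
    (\sum_(k <- s) a k * eps k w) ^+ p - (\sum_(k <- s') a k * eps k w) ^+ p) @^-1` B).
Proof.
move=> sG s'G B mB.
pose U := \bigcup_(j in G) preimage_set_system setT (eps j) measurable.
have mX (r : seq ('I_d -> int)) : (forall k, k \in r -> G k) ->
    measurable_fun (setT : set (g_sigma_algebraType U))
      (fun w : g_sigma_algebraType U => (\sum_(k <- r) a k * eps k w) ^+ p).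
  move=> rG; apply: measurable_funX.
  elim: r rG => [|k r IH] rG; first by under eq_fun do rewrite big_nil; exact: measurable_cst.
  under eq_fun do rewrite big_cons; apply: measurable_funD; last first.
    by apply: IH => l lr; apply: rG; rewrite inE lr orbT.
  apply: measurable_funM => // _ C mC; rewrite setTI; apply: sub_sigma_algebra.
  exists k; first exact/rG/mem_head.
  by exists C => //; rewrite setTI.
have /(_ measurableT B mB) := measurable_funB (mX s sG) (mX s' s'G).
by rewrite setTI.
Qed.

End Stationarity.

(** * Moment inequality for weighted sums *)

Section MomentInequality.
Context {R : realType} {dT : measure_display} {T : measurableType dT} {d : nat}.
Variables (P : probability T R) (eps : ('I_d -> int) -> T -> R).
(** With the order fixed, [al0] and [al k] bound the L^(n+1) norms of eps_0^2 and of eps_k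
    E_|k|(eps_0), and [alT] bounds all their finite sums. *)
Variables (Em : nat -> T -> R) (n : nat) (al0 alT : R) (al : ('I_d -> int) -> R).
Hypothesis measurable_eps : forall i, measurable_fun setT (eps i).
Hypothesis stationary_eps : strictly_stationary P eps.
Hypothesis moments_eps : all_moments P (eps (@zzero d)).
Hypothesis cond_exp_Em : forall m, (1 <= m)%N ->
  cond_exp_version P (eps (@zzero d)) (FGamma eps (Vset m (@zzero d))) (Em m).
Hypothesis moments_Em : forall k, Vset 1 (@zzero d) k ->
  all_moments P (fun w => eps k w * Em (zdist k (@zzero d)) w).
Hypothesis al_ge0 : forall k, 0 <= al k.
Hypothesis al_Em : forall k, Vset 1 (@zzero d) k ->
  \int[P]_w (`|eps k w * Em (zdist k (@zzero d)) w| ^+ n.+1) <= al k ^+ n.+1.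
Hypothesis al0_gt0 : 0 < al0.
Hypothesis al0_eps : \int[P]_w (eps (@zzero d) w ^+ n.+1.*2) <= al0 ^+ n.+1.
Hypothesis al_sum : forall s : seq ('I_d -> int), uniq s ->
  (forall k, k \in s -> Vset 1 (@zzero d) k) -> al0 + \sum_(k <- s) al k <= alT.

Let S (a : ('I_d -> int) -> R) s w := \sum_(j <- s) a j * eps j w.

Let am_eps i : all_moments P (eps i).
Proof. exact: stationary_all_moments. Qed.

Let am_S a s : all_moments P (S a s).
Proof. by apply: all_moments_sum => i _; exact: all_momentsZ. Qed.

Let even_pow (x : R) k : x ^+ k.*2 = (x ^+ 2) ^+ k.
Proof. by rewrite -exprM mul2n. Qed.

Let mul_even_le Z Y bnd x : all_moments P Z -> all_moments P Y -> 0 <= bnd -> 0 < x ->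
  \int[P]_w (`|Z w| ^+ n.+1) <= bnd ^+ n.+1 -> \int[P]_w (Y w ^+ n.+1.*2) <= x ^+ n.+1 ->
  \int[P]_w (`|Z w| * Y w ^+ n.*2) <= 2 * bnd * x ^+ n.
Proof.
move=> aZ aY b0 x0 ZS YS; under eq_Rintegral do rewrite even_pow.
apply: Rintegral_mulX_le => //; first exact: all_momentsX.
- by move=> w; exact: sqr_ge0.
- by under eq_Rintegral do rewrite -even_pow.
Qed.

(** All points of [t] are at least as far from the origin as [k], so the increment [D] is measurable
    for the field of V_0^|k| and [eps 0] may be replaced by its conditional expectation [E]. As [D]
    carries a factor [eps k], the product controlled by [al k] appears. *)
Lemma dist_removal (b : ('I_d -> int) -> R) t k x :
  k \in t -> (forall j, j \in t -> Vset 1 (@zzero d) j) ->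
  (forall j, j \in t -> zdist k (@zzero d) <= zdist j (@zzero d))%N ->
  `|b k| <= 1 -> 0 < x ->
  \int[P]_w (S b t w ^+ n.+1.*2) <= x ^+ n.+1 ->
  \int[P]_w (S b (rem k t) w ^+ n.+1.*2) <= x ^+ n.+1 ->
  `|\int[P]_w (eps (@zzero d) w * S b t w ^+ n.*2.+1) -
    \int[P]_w (eps (@zzero d) w * S b (rem k t) w ^+ n.*2.+1)| <= 8 * n.+1%:R * al k * x ^+ n.
Proof.
move=> kt tV kmin bk x0 Ht Ht'.
pose D w := S b t w ^+ n.*2.+1 - S b (rem k t) w ^+ n.*2.+1.
pose E := Em (zdist k (@zzero d)); have kV := tV _ kt.
have k1 : (1 <= zdist k (@zzero d))%N by rewrite zdistC; case: kV.
have inV j : j \in t -> Vset (zdist k (@zzero d)) (@zzero d) j.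
  by move=> jt; split; [case: (tV _ jt)|rewrite [X in (_ <= X)%N]zdistC kmin].
have aD : all_moments P D.
  rewrite /D; under eq_fun do rewrite -mulN1r.
  by apply: all_momentsD; [|apply: all_momentsZ]; exact: all_momentsX.
have SE w : S b t w - S b (rem k t) w = b k * eps k w.
  by rewrite /S (perm_big _ (perm_to_rem kt)) big_cons/= addrK.
pose B w := n.*2.+1%:R * (`|eps k w * E w| * (S b t w ^+ n.*2) +
                          `|eps k w * E w| * (S b (rem k t) w ^+ n.*2)).
have aB1 r : all_moments P (fun w => `|eps k w * E w| * (S b r w ^+ n.*2)).
  by apply: all_momentsM; [apply/all_moments_norm/moments_Em|exact: all_momentsX].
have aB : all_moments P B by apply/all_momentsZ/all_momentsD.
have EDB w : `|E w * D w| <= B w.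
  rewrite /B -mulrDr normrM (le_trans (ler_wpM2l _ (norm_subrX_le_even _ _ _)))//.
  rewrite SE normrM mulrCA ler_wpM2l// mulrA normrM ler_wpM2r ?addr_ge0 ?exprn_double_ge0//.
  by rewrite mulrC ler_wpM2r// ler_piMl.
have [GE iE _] := cond_exp_Em k1.
have mE : measurable_fun setT E by exact/measurable_EFinP/(measurable_int P).
(* [E] alone is only known to be integrable; integrability of the product comes from the domination
   by [B]. *)
have iED : P.-integrable setT (EFin \o (fun w => E w * D w)).
  apply: integrable_norm_le (all_moments_integrable aB) EDB.
  by apply: measurable_funM => //; case: aD.
rewrite -RintegralB//; [|apply/all_moments_integrable/all_momentsM => //; exact: all_momentsX..].
under eq_Rintegral do rewrite -mulrBr.
rewrite (cond_exp_mul (cond_exp_Em k1) (W := D)) //; first last.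
- exact/all_moments_integrable/all_momentsM.
- exact/all_moments_integrable.
- apply: FGamma_measurable_diff; first exact: inV.
  by move=> j /mem_rem; exact: inV.
- by move=> A; exact: FGamma_measurable.
rewrite (le_trans (le_normr_Rintegral measurableT iED))//.
apply: le_trans (_ : \int[P]_w B w <= _).
  apply: le_Rintegral => //; [|exact: all_moments_integrable].
  exact: integrable_norm iED.
rewrite all_moments_RintegralZ; last exact: all_momentsD.
rewrite all_moments_RintegralD//.
have K1 := mul_even_le (moments_Em kV) (am_S b t) (al_ge0 k) x0 (al_Em kV) Ht.
have K2 := mul_even_le (moments_Em kV) (am_S b (rem k t)) (al_ge0 k) x0 (al_Em kV) Ht'.
apply: (@le_trans _ _ (n.*2.+1%:R * (2 * al k * x ^+ n + 2 * al k * x ^+ n))).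
  by rewrite ler_wpM2l// lerD.
(* The constant 8: a factor 2 from each of the two Hölder bounds, and [n.*2.+1 <= 2 * n.+1]. *)
have -> : 8 * n.+1%:R * al k * x ^+ n = (2 * n.+1%:R) * (2 * al k * x ^+ n + 2 * al k * x ^+ n).
  by ring.
apply: ler_wpM2r; last by rewrite -[2]/(2%:R) -natrM ler_nat mul2n doubleS.
by rewrite addr_ge0// !mulr_ge0// exprn_ge0// ltW.
Qed.

(* Removing the points one at a time, nearest first, makes each increment measurable for a field on
   which [eps 0] has a small conditional expectation. *)
Lemma centered_product_le (b : ('I_d -> int) -> R) t x :
  uniq t -> (forall j, j \in t -> Vset 1 (@zzero d) j) -> (forall j, `|b j| <= 1) -> 0 < x ->
  (forall r, uniq r -> (size r <= size t)%N -> \int[P]_w (S b r w ^+ n.+1.*2) <= x ^+ n.+1) ->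
  `|\int[P]_w (eps (@zzero d) w * S b t w ^+ n.*2.+1)| <=
    8 * n.+1%:R * (\sum_(k <- t) al k) * x ^+ n.
Proof.
move=> ut tV b1 x0; move: {2}(size t) (erefl (size t)) => N.
elim: N t ut tV => [|N IH] t ut tV st Hr.
  (* The telescoping ends at the empty sum, whose positive power is [0]. *)
  move/size0nil : st => ->; rewrite big_nil mulr0 mul0r.
  under eq_Rintegral do rewrite /S big_nil expr0n mulr0.
  by rewrite Rintegral_cst// mul0r normr0.
have [k kt kmin] : exists2 k, k \in t &
    forall j, j \in t -> (zdist k (@zzero d) <= zdist j (@zzero d))%N.
  case: t st {ut tV Hr} => // k0 t _.
  elim: t k0 => [|y t IHt] k0; first by exists k0; rewrite ?mem_head// => j; rewrite inE => /eqP->.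
  have [k kt kmin] := IHt y.
  have [le|/ltnW le] := leqP (zdist k0 (@zzero d)) (zdist k (@zzero d)).
    exists k0; first exact: mem_head.
    by move=> j; rewrite inE => /orP[/eqP->//|/kmin]; exact: leq_trans.
  exists k; first by rewrite inE kt orbT.
  by move=> j; rewrite inE => /orP[/eqP->//|/kmin].
have str : size (rem k t) = N by rewrite size_rem// st.
have utr : uniq (rem k t) by exact: rem_uniq.
have H1 : `|\int[P]_w (eps (@zzero d) w * S b (rem k t) w ^+ n.*2.+1)| <=
    8 * n.+1%:R * (\sum_(k <- rem k t) al k) * x ^+ n.
  apply: IH => // [j /mem_rem/tV//|r ur sr]; apply: Hr => //.
  by rewrite (leq_trans sr)// str st.
have H2 := dist_removal kt tV kmin (b1 k) x0 (Hr _ ut (leqnn _)) (Hr _ utr _).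
rewrite (perm_big _ (perm_to_rem kt)) big_cons/= mulrDr mulrDl.
rewrite -[X in `|X|](subrK (\int[P]_w (eps (@zzero d) w * S b (rem k t) w ^+ n.*2.+1))).
rewrite (le_trans (ler_normD _ _))// lerD// H2//.
by rewrite str st.
Qed.

(** Sum of the constants 16, 8 exp 2 + 8 and 4 that multiply [n.+1 ^ 2 * alT * x ^ n] in the
    induction step: they come from the cross term, from the remainder with the old sum, and from the
    pure power of the new error. *)
Let C0 : R := 28 + 8 * expR 2.

Let C0_ge : 28 <= C0.
Proof. by rewrite lerDl mulr_ge0// expR_ge0. Qed.

Let al0_le : al0 <= alT.
Proof. by have := al_sum (s := [::]) isT; rewrite big_nil addr0; apply. Qed.

Let eps_pow i : \int[P]_w (eps i w ^+ n.+1.*2) <= al0 ^+ n.+1.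
Proof.
by rewrite (stationary_Rintegral measurable_eps stationary_eps (F := fun y => y ^+ n.+1.*2)) //.
Qed.

(** For so few points dependence does not matter: the triangle inequality gives the square of
    [size s] in the base, at most [n.+1 * size s]. *)
Let moment_small (a : ('I_d -> int) -> R) s : (forall j, `|a j| <= 1) -> (size s <= n.+1)%N ->
  \int[P]_w (S a s w ^+ n.+1.*2) <= (C0 * n.+1%:R * (size s)%:R * alT) ^+ n.+1.
Proof.
move=> a1 sn.
have am i : all_moments P (fun w => (a i * eps i w) ^+ n.+1.*2).
  by apply: all_momentsX; exact: all_momentsZ.
have := @Rintegral_le _ _ _ P (fun w => S a s w ^+ n.+1.*2)
  (fun w => (size s)%:R ^+ n.+1.*2 * \sum_(i <- s) (a i * eps i w) ^+ n.+1.*2).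
move=> /(_ (all_momentsX _ (am_S a s)) (all_momentsZ _ (all_moments_sum (fun i _ => am i)))
  (fun w => sum_expr_even_le _ _ _))/le_trans; apply.
rewrite all_moments_RintegralZ; last exact: all_moments_sum.
rewrite all_moments_Rintegral_sum//.
have le1 i : \int[P]_w ((a i * eps i w) ^+ n.+1.*2) <= al0 ^+ n.+1.
  under eq_Rintegral do rewrite exprMn.
  rewrite all_moments_RintegralZ; last exact: all_momentsX.
  apply: le_trans (eps_pow i); rewrite ler_piMl ?Rintegral_ge0// => [w _|].
    exact: exprn_double_ge0.
  by rewrite even_pow exprn_ile1 ?sqr_ge0// -real_normK ?num_real// exprn_ile1.
(* The number of terms is at most [2 ^ n.+1], and so enters the base as a mere factor 2. *)
have sum_le : \sum_(i <- s) \int[P]_w ((a i * eps i w) ^+ n.+1.*2) <= 2 ^+ n.+1 * al0 ^+ n.+1.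
  apply: (@le_trans _ _ (\sum_(i <- s) al0 ^+ n.+1)); first exact: ler_sum.
  rewrite big_const_seq count_predT iter_addr_0 -[leLHS]mulr_natl.
  apply: ler_wpM2r; first by rewrite exprn_ge0 ?ltW.
  by rewrite -natrX ler_nat (leq_trans sn)// ltnW// ltn_expl.
apply: (@le_trans _ _ ((size s)%:R ^+ n.+1.*2 * (2 ^+ n.+1 * al0 ^+ n.+1))).
  by rewrite ler_wpM2l// exprn_ge0.
rewrite even_pow -!exprMn lerXn2r ?nnegrE//.
- by rewrite !mulr_ge0 ?sqr_ge0// ltW.
- by rewrite !mulr_ge0// ?(le_trans _ C0_ge)// (le_trans _ al0_le)// ltW.
have al00 := ltW al0_gt0; rewrite mulrA; apply: ler_pM => //.
rewrite expr2 mulrAC; apply: ler_wpM2r => //; rewrite mulrC; apply: ler_pM => //.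
  by have := C0_ge; lra.
by rewrite ler_nat.
Qed.

(** Absorbs the cost of one more point: an increment linear in [y] becomes a growth of the base from
    [x] to [x + y]. *)
Lemma bernoulli_le (x y : R) k : 0 <= x -> 0 <= y ->
  x ^+ k.+1 + k.+1%:R * y * x ^+ k <= (x + y) ^+ k.+1.
Proof.
move=> x0 y0; elim: k => [|k IH]; first by rewrite !expr1 expr0 mulr1 mul1r.
rewrite [leRHS]exprS (le_trans _ (ler_wpM2l _ IH)) ?addr_ge0//.
have -> : (x + y) * (x ^+ k.+1 + k.+1%:R * y * x ^+ k) =
   x ^+ k.+2 + k.+2%:R * y * x ^+ k.+1 + k.+1%:R * (y * y * x ^+ k).
  by rewrite -(natr1 k.+1) !exprS; ring.
by rewrite lerDl !mulr_ge0 ?exprn_ge0.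
Qed.

(** The induction runs over all lists up to a given size and over all weights bounded by 1: the
    estimate of the cross term uses the bound for sublists and for the translated list with
    translated weights. *)
Lemma moment_inequality (a : ('I_d -> int) -> R) s : uniq s -> (forall j, `|a j| <= 1) ->
  \int[P]_w ((\sum_(j <- s) a j * eps j w) ^+ n.+1.*2) <=
    ((28 + 8 * expR 2) * n.+1%:R * (size s)%:R * alT) ^+ n.+1.
Proof.
have alT0 : 0 < alT by exact: lt_le_trans al0_le.
have C00 : 0 < C0 by rewrite (lt_le_trans _ C0_ge).
rewrite -/C0; move: {2}(size s) (leqnn (size s)) => N.
elim: N s a => [|N IH] s a sN us a1; first by rewrite moment_small// (leq_trans sN).
have [sn|ns] := leqP (size s) n.+1; first exact: moment_small.
have [i si imax] : exists2 i, i \in s & forall j, j \in s -> j <> i -> lexlt j i.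
  by apply: exists_lexmax; rewrite -size_eq0 -lt0n (leq_ltn_trans _ ns).
pose s' := rem i s; pose M := (size s').
have sM : size s = M.+1 by rewrite /M size_rem// prednK// (leq_ltn_trans _ ns).
have nM : (n.+1 <= M)%N by move: ns; rewrite sM.
have MN : (M <= N)%N by move: sN; rewrite sM.
have us' : uniq s' by exact: rem_uniq.
pose x := C0 * n.+1%:R * M%:R * alT.
have M1 : (n.+1%:R : R) <= M%:R by rewrite ler_nat.
have x0 : 0 < x by rewrite !mulr_gt0// (lt_le_trans _ M1).
(* The earlier points as seen from [i]; [b] carries their weights along. *)
pose t := [seq (fun l => j l - i l) | j <- s'].
pose b k := a (fun l => k l + i l).
have bj j : b (fun l => j l - i l) = a j by congr a; apply/funext => l; rewrite subrK.
have ut : uniq t.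
  rewrite map_inj_uniq// => j j' e; apply/funext => l.
  by have /(congr1 (fun f => f l))/addIr := e.
have tV j : j \in t -> Vset 1 (@zzero d) j.
  move=> /mapP[j' j's' ->]; apply: Vset_sub; apply: imax; first exact: mem_rem j's'.
  by move=> j'i; move: j's'; rewrite j'i mem_rem_uniqF.
have le_x r (c : ('I_d -> int) -> R) : uniq r -> (forall j, `|c j| <= 1) -> (size r <= M)%N ->
    \int[P]_w (S c r w ^+ n.+1.*2) <= x ^+ n.+1.
  move=> ur c1 rM; rewrite (le_trans (IH _ _ (leq_trans rM MN) ur c1))//.
  have p0 k : 0 <= C0 * n.+1%:R * k%:R by rewrite !mulr_ge0// ltW.
  have pT k : 0 <= C0 * n.+1%:R * k%:R * alT by rewrite mulr_ge0// ltW.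
  rewrite lerXn2r ?nnegrE ?pT// /x ler_pM2r// ler_wpM2l//; last by rewrite ler_nat.
  by have := p0 1%N; rewrite mulr1.
have Sx : \int[P]_w (S a s' w ^+ n.+1.*2) <= x ^+ n.+1 by exact: le_x.
have cross : `|\int[P]_w (eps i w * S a s' w ^+ n.*2.+1)| <= 8 * n.+1%:R * alT * x ^+ n.
  rewrite /S stationary_sum//.
  have -> : \int[P]_w (eps (@zzero d) w * (\sum_(j <- s') a j * eps (fun l => j l - i l) w) ^+ n.*2.+1)
     = \int[P]_w (eps (@zzero d) w * S b t w ^+ n.*2.+1).
    apply: eq_Rintegral => w _; congr (_ * _ ^+ _); rewrite /S /t big_map.
    by apply: eq_bigr => j _; rewrite bj.
  apply: (le_trans (@centered_product_le b t x ut tV _ x0 _)).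
  - by move=> j; exact: a1.
  - by move=> r ur; rewrite size_map => rM; apply: le_x => // j; exact: a1.
  - apply: ler_wpM2r; first by rewrite exprn_ge0 ?ltW.
    rewrite ler_wpM2l ?mulr_ge0//.
    by rewrite (le_trans _ (al_sum ut tV))// lerDr ltW.
pose Z w := eps i w ^+ 2.
have aZ : all_moments P Z by exact: all_momentsX.
have sq : \int[P]_w (`|Z w| * S a s' w ^+ n.*2) <= 2 * al0 * x ^+ n.
  apply: mul_even_le => //; first exact: ltW.
  under eq_Rintegral do rewrite ger0_norm ?sqr_ge0// -even_pow.
  exact: eps_pow.
have aZS : all_moments P (fun w => `|Z w| * S a s' w ^+ n.*2).
  by apply: all_momentsM; [exact: all_moments_norm|exact: all_momentsX].
have aE : all_moments P (fun w => eps i w ^+ n.+1.*2) by exact: all_momentsX.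
have aX : all_moments P (fun w => eps i w * S a s' w ^+ n.*2.+1).
  by apply: all_momentsM => //; exact: all_momentsX.
pose m2 : R := n.+1.*2%:R; pose c2 : R := n.+2%:R ^+ n.*2.
(* Taylor expansion at the old sum, with the power of the new sum in the remainder split by
   [exprD_even_le], whence [expR 2] and [c2]; the [+ 1] is the power of the old sum already present
   in the remainder. *)
pose Q w := S a s' w ^+ n.+1.*2 + (m2 * a i * (eps i w * S a s' w ^+ n.*2.+1) +
  (m2 ^+ 2 * (expR 2 + 1) * (`|Z w| * S a s' w ^+ n.*2) + m2 ^+ 2 * c2 * eps i w ^+ n.+1.*2)).
have SQ w : S a s w ^+ n.+1.*2 <= Q w.
  have -> : S a s w = S a s' w + a i * eps i w.
    by rewrite addrC /S (perm_big _ (perm_to_rem si)) big_cons.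
  have ai2 : a i ^+ 2 <= 1 by rewrite -real_normK ?num_real// exprn_ile1.
  have K1 : (a i * eps i w) ^+ 2 * ((S a s' w + a i * eps i w) ^+ n.*2 + S a s' w ^+ n.*2) <=
      (expR 2 + 1) * (`|Z w| * S a s' w ^+ n.*2) + c2 * eps i w ^+ n.+1.*2.
    have -> : eps i w ^+ n.+1.*2 = Z w * eps i w ^+ n.*2 by rewrite /Z -exprD.
    rewrite ger0_norm ?sqr_ge0// exprMn -/(Z w).
    have -> : (expR 2 + 1) * (Z w * S a s' w ^+ n.*2) + c2 * (Z w * eps i w ^+ n.*2) =
      Z w * ((expR 2 * S a s' w ^+ n.*2 + c2 * eps i w ^+ n.*2) + S a s' w ^+ n.*2) by ring.
    apply: ler_pM.
    - by rewrite mulr_ge0// sqr_ge0.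
    - by rewrite addr_ge0// exprn_double_ge0.
    - by rewrite ler_piMl// sqr_ge0.
    rewrite lerD2r (le_trans (exprD_even_le _ _ _))// lerD2l ler_wpM2l ?exprn_double_ge0//.
    rewrite exprMn ler_piMl ?exprn_double_ge0// even_pow exprn_ile1// sqr_ge0//.
  have {}K1 := ler_wpM2l (sqr_ge0 m2) K1.
  apply: le_trans (taylor2_even_le _ _ _) _.
  rewrite /Q -/m2; move: K1; rewrite -!mulrA mulrDr; lra.
have aQ3 : all_moments P (fun w => m2 ^+ 2 * (expR 2 + 1) * (`|Z w| * S a s' w ^+ n.*2) +
    m2 ^+ 2 * c2 * eps i w ^+ n.+1.*2).
  by apply: all_momentsD; exact: all_momentsZ.
have aQ2 := all_momentsD (all_momentsZ (m2 * a i) aX) aQ3.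
have aQ1 := all_momentsX n.+1.*2 (am_S a s').
have aQ : all_moments P Q by exact: all_momentsD.
apply: le_trans (Rintegral_le (all_momentsX n.+1.*2 (am_S a s)) aQ SQ) _.
rewrite all_moments_RintegralD// all_moments_RintegralD//; last exact: all_momentsZ.
rewrite all_moments_RintegralD; [|exact: all_momentsZ..].
rewrite !all_moments_RintegralZ//.
(* Uses that many points are present: as [M >= n.+1], one has [n.+2 ^ 2 <= 4 * n.+1 ^ 2 <= C0 * n.+1
   * M], so [n.+2 ^ 2 * al0 <= x]. *)
have c2x : c2 * al0 ^+ n.+1 <= alT * x ^+ n.
  rewrite /c2 even_pow [al0 ^+ _]exprS mulrCA -exprMn.
  have al00 := ltW al0_gt0; have x00 := ltW x0.
  apply: ler_pM => //; first by rewrite exprn_ge0// mulr_ge0// sqr_ge0.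
  rewrite lerXn2r ?nnegrE//; first by rewrite mulr_ge0// sqr_ge0.
  apply: (@le_trans _ _ (n.+2%:R ^+ 2 * alT)); first by rewrite ler_wpM2l// sqr_ge0.
  apply: ler_wpM2r; first exact: ltW.
  apply: (@le_trans _ _ (4 * n.+1%:R * n.+1%:R)).
    rewrite -(natr1 n.+1); have : (1 : R) <= n.+1%:R by rewrite ler1n.
    move: (n.+1%:R : R) => y y1; have := sqr_ge0 (y - 1); nra.
  rewrite -!mulrA ler_pM//; first by have := C0_ge; lra.
  by rewrite ler_wpM2l.
have m2E : m2 = 2 * n.+1%:R by rewrite /m2 -muln2 natrM mulrC.
have xn0 : 0 <= x ^+ n by rewrite exprn_ge0// ltW.
have -> : C0 * n.+1%:R * (size s)%:R * alT = x + C0 * n.+1%:R * alT.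
  by rewrite sM -natr1 /x; ring.
apply: le_trans (bernoulli_le n (ltW x0) _); last by rewrite !mulr_ge0// ltW.
apply: lerD => //.
have m20 : 0 <= m2 by rewrite m2E mulr_ge0.
have T1 : m2 * a i * \int[P]_w (eps i w * S a s' w ^+ n.*2.+1) <= m2 * (8 * n.+1%:R * alT * x ^+ n).
  rewrite -mulrA ler_wpM2l// (le_trans (ler_norm _))// normrM (le_trans _ cross)//.
  by rewrite ler_piMl.
have T2 : m2 ^+ 2 * (expR 2 + 1) * \int[P]_w (`|Z w| * S a s' w ^+ n.*2) <=
    m2 ^+ 2 * (expR 2 + 1) * (2 * alT * x ^+ n).
  apply: ler_wpM2l; first by apply: mulr_ge0; [exact: sqr_ge0|rewrite addr_ge0 ?expR_ge0].
  apply: (le_trans sq).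
  by rewrite ler_wpM2r// ler_wpM2l.
have T3 : m2 ^+ 2 * c2 * \int[P]_w (eps i w ^+ n.+1.*2) <= m2 ^+ 2 * (alT * x ^+ n).
  rewrite -mulrA; apply: ler_wpM2l; first exact: sqr_ge0.
  by apply: le_trans c2x; rewrite ler_wpM2l// exprn_ge0.
apply: le_trans (lerD T1 (lerD T2 T3)) _.
by rewrite m2E /C0 le_eqVlt; apply/orP; left; apply/eqP; ring.
Qed.

End MomentInequality.

(** * Moments controlled by the Orlicz norm *)

Section OrliczMoments.
Context {R : realType} {dT : measure_display} {T : measurableType dT}.
Variable P : probability T R.
Implicit Types (Z : T -> R) (beta s u y c : R).

(** The power [s] of u / s <= exp(u / s). *)
Lemma powR_le_expR s u : 0 < s -> 0 <= u -> u `^ s <= s `^ s * expR u.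
Proof.
move=> s0 u0.
have us0 : 0 <= u / s by rewrite divr_ge0// ltW.
have e : s * (u / s) = u by rewrite mulrC divfK ?gt_eqF.
rewrite -{1}e powRM ?(ltW s0)// ler_wpM2l ?powR_ge0//.
have -> : expR u = expR (u / s) `^ s by rewrite /powR gt_eqF ?expR_gt0// expRK e.
rewrite ge0_ler_powR ?nnegrE ?expR_ge0// ?(ltW s0)//.
by rewrite (le_trans _ (expR_ge1Dx _))// lerDr.
Qed.

(** The previous bound for u = y^beta and s = k / beta; it fixes the growth of the moments in
    [k]. *)
Lemma exprn_le_expR_powR beta y k : 0 < beta -> 0 <= y -> (0 < k)%N ->
  y ^+ k <= (k%:R / beta) `^ (k%:R / beta) * expR (y `^ beta).
Proof.
move=> b0 y0 k0; have kb : 0 < k%:R / beta by rewrite divr_gt0// ltr0n.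
have := powR_le_expR kb (powR_ge0 y beta).
by rewrite -powRrM mulrC divfK ?gt_eqF// powR_mulrn.
Qed.

(** Bounds the mean of exp(y^beta) when that of [psi_beta beta y] is at most 1; the second term
    restores the constant subtracted in [psi_beta]. *)
Definition psi_const beta : R := 1 + expR (xi_beta beta `^ beta).

Lemma xi_beta_ge0 beta : 0 <= xi_beta beta.
Proof. by rewrite /xi_beta; case: ifP => // _; exact: powR_ge0. Qed.

Lemma psi_beta_ge beta y : 0 < beta -> 0 <= y ->
  expR (y `^ beta) <= psi_beta beta y + expR (xi_beta beta `^ beta).
Proof.
move=> b0 y0; rewrite /psi_beta subrK ler_expR ge0_ler_powR ?nnegrE ?(ltW b0)//.
  by rewrite addr_ge0// xi_beta_ge0.
by rewrite lerDl xi_beta_ge0.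
Qed.

Lemma psi_beta_ge0 beta y : 0 < beta -> 0 <= y -> 0 <= psi_beta beta y.
Proof.
move=> b0 y0; rewrite /psi_beta subr_ge0 ler_expR ge0_ler_powR ?nnegrE ?(ltW b0)//.
- exact: xi_beta_ge0.
- by rewrite addr_ge0// xi_beta_ge0.
- by rewrite lerDr.
Qed.

Lemma measurable_psi_beta beta : measurable_fun setT (psi_beta beta).
Proof.
apply: measurable_funB => //; apply: measurableT_comp => //.
apply: (@measurableT_comp _ _ _ _ _ _ (fun x => x `^ beta)) => //.
exact: measurable_funD.
Qed.

(** An extended real bound, because it also yields the integrability of the powers. *)
Lemma integral_exprn_le beta Z c k : 0 < beta -> measurable_fun setT Z -> 0 < c ->
  (\int[P]_w (psi_beta beta (`|Z w| / c))%:E <= 1)%E -> (0 < k)%N ->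
  (\int[P]_w (`|Z w| ^+ k)%:E <=
    (c ^+ k * (k%:R / beta) `^ (k%:R / beta) * psi_const beta)%:E)%E.
Proof.
move=> b0 mZ c0 psi1 k0; set L := (k%:R / beta) `^ _; set xi := expR (xi_beta beta `^ beta).
have cL0 : 0 <= c ^+ k * L by rewrite mulr_ge0 ?powR_ge0// exprn_ge0// ltW.
have mpsi : measurable_fun setT (fun w => (psi_beta beta (`|Z w| / c))%:E).
  apply/measurable_EFinP; apply: measurableT_comp; first exact: measurable_psi_beta.
  by apply: measurable_funM => //; exact: measurableT_comp.
have y0 w : 0 <= `|Z w| / c by rewrite divr_ge0// ltW.
have psi0 w : (0 <= (psi_beta beta (`|Z w| / c))%:E)%E.
  by rewrite lee_fin psi_beta_ge0.
apply: (@le_trans _ _ (\int[P]_w ((c ^+ k * L)%:E * ((psi_beta beta (`|Z w| / c))%:E + xi%:E))))%E.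
  apply: ge0_le_integral => //.
  - by apply/measurable_EFinP/measurable_funX; exact: measurableT_comp.
  - by apply: measurable_funeM; exact: emeasurable_funD.
  - move=> w _; rewrite -EFinD -EFinM lee_fin.
    have -> : `|Z w| ^+ k = c ^+ k * (`|Z w| / c) ^+ k.
      by rewrite -exprMn mulrC divfK// gt_eqF.
    rewrite -mulrA ler_wpM2l ?exprn_ge0 ?(ltW c0)//.
    rewrite (le_trans (exprn_le_expR_powR b0 (y0 w) k0))// ler_wpM2l ?powR_ge0//.
    exact: psi_beta_ge.
rewrite ge0_integralZl//; last 2 first.
- exact: emeasurable_funD.
- by move=> w _; rewrite adde_ge0// lee_fin expR_ge0.
rewrite ge0_integralD//; last by move=> w _; rewrite lee_fin expR_ge0.
have -> : (\int[P]_w xi%:E)%E = xi%:E.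
  rewrite (integral_cst P measurableT) -[RHS]mule1; congr (_ * _)%E.
  exact: probability_setT.
rewrite [leRHS]EFinM lee_wpmul2l ?lee_fin//.
by rewrite /psi_const EFinD leeD2r.
Qed.

Lemma orlicz_all_moments beta Z : 0 < beta -> measurable_fun setT Z ->
  in_Lpsi P beta Z -> all_moments P Z.
Proof.
move=> b0 mZ /ereal_inf_lt[_ [c [c0 psi1] <-] _].
split=> // -[|k]; first exact: finite_measure_integrable_cst.
apply/integrableP; split; first by apply/measurable_EFinP; exact: measurable_funX.
under eq_integral do rewrite abse_EFin normrX.
exact: le_lt_trans (integral_exprn_le b0 mZ c0 psi1 (ltn0Sn k)) (ltry _).
Qed.

(** Bounds the ratio of the squared L^(2m) norm to the squared Orlicz norm, for m = [n.+1]; as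
    [psi_const beta >= 1], it may be moved inside the m-th power. *)
Definition orlicz_factor beta (n : nat) : R :=
  ((n.+1.*2)%:R / beta) `^ (2 / beta) * psi_const beta.

(** The infimum in the norm need not be attained. The bound holds for each admissible [c]; read
    backwards, the normalized root [v] of the moment is below every such [c], hence below the
    norm. *)
Lemma orlicz_moment_le beta Z n : 0 < beta -> measurable_fun setT Z ->
  in_Lpsi P beta Z ->
  \int[P]_w (Z w ^+ n.+1.*2) <= (orlicz_factor beta n * fine (orlicz_norm P beta Z) ^+ 2) ^+ n.+1.
Proof.
move=> b0 mZ LZ; set L := orlicz_factor beta n; set V := Rintegral _ _ _.
have K0 : 0 < (n.+1.*2)%:R / beta by rewrite divr_gt0// ltr0n.
have psi1 : 1 <= psi_const beta by rewrite lerDl expR_ge0.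
have L0 : 0 < L by rewrite mulr_gt0 ?powR_gt0// (lt_le_trans _ psi1).
have V0 : 0 <= V by apply: Rintegral_ge0 => w _; exact: exprn_double_ge0.
have Vc c : 0 < c -> (\int[P]_w (psi_beta beta (`|Z w| / c))%:E <= 1)%E ->
    V <= (L * c ^+ 2) ^+ n.+1.
  move=> c0 Hc; have := integral_exprn_le b0 mZ c0 Hc (ltn0Sn n.*2.+1).
  rewrite -doubleS; under eq_integral do rewrite -normrX ger0_norm ?exprn_double_ge0//.
  move=> /fine_le; rewrite -/V => /(_ _ _)/le_trans; apply => //=.
    by rewrite integrable_fin_num//; have [_] := orlicz_all_moments b0 mZ LZ; apply.
  have -> : (n.+1.*2%:R / beta) `^ (n.+1.*2%:R / beta) =
      ((n.+1.*2%:R / beta) `^ (2 / beta)) ^+ n.+1.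
    rewrite -[RHS]powR_mulrn ?powR_ge0// -[RHS]powRrM; congr (_ `^ _).
    by rewrite -muln2 natrM; field; rewrite gt_eqF.
  rewrite [leRHS]exprMn [leRHS]mulrC -exprM mul2n -mulrA ler_wpM2l ?exprn_ge0 ?(ltW c0)//.
  by rewrite exprMn ler_wpM2l ?exprn_ge0 ?powR_ge0// exprS ler_peMr ?exprn_ege1// (le_trans _ psi1).
pose v := (V / L ^+ n.+1) `^ (n.+1.*2%:R)^-1.
have vE : V = L ^+ n.+1 * v ^+ n.+1.*2.
  rewrite /v -[X in _ = _ * X]powR_mulrn ?powR_ge0// -powRrM mulVf ?pnatr_eq0// powRr1 ?divr_ge0 ?exprn_ge0 ?(ltW L0)//.
  by rewrite mulrC divfK// expf_neq0// gt_eqF.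
have vle : (v%:E <= orlicz_norm P beta Z)%E.
  apply: le_ereal_inf_tmp => _ [c [c0 Hc] <-]; rewrite lee_fin leNgt; apply/negP => cv.
  have := Vc _ c0 Hc; rewrite vE [(L * _) ^+ _]exprMn -exprM mul2n ler_pM2l ?exprn_gt0// leNgt => /negP; apply.
  by rewrite ltr_pXn2r ?nnegrE ?(ltW c0)// powR_ge0.
have vr : v <= fine (orlicz_norm P beta Z).
  rewrite -lee_fin fineK// ge0_fin_numE//.
  by rewrite (le_trans _ vle)// lee_fin powR_ge0.
rewrite vE [(L * _) ^+ _]exprMn -exprM mul2n ler_wpM2l ?exprn_ge0 ?(ltW L0)//.
by rewrite lerXn2r// nnegrE ?powR_ge0// (le_trans _ vr)// powR_ge0.
Qed.

Lemma all_moments_le (X Y : T -> R) : measurable_fun setT X -> all_moments P Y ->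
  (forall w, `|X w| <= Y w) -> all_moments P X.
Proof.
move=> mX aY XY; apply: all_moments_even => // n.
apply: integrable_norm_le (aY.2 n.*2) _; first exact: measurable_funX.
by move=> w; rewrite normrX lerXn2r// nnegrE// (le_trans _ (XY w)).
Qed.

End OrliczMoments.

(** * The moment bound under condition (C2) *)

Section MomentBound.
Context {R : realType} {dT : measure_display} {T : measurableType dT} {d : nat}.
Variables (P : probability T R) (eps : ('I_d -> int) -> T -> R) (q : R).
Hypothesis measurable_eps : forall i, measurable_fun setT (eps i).
Hypothesis stationary_eps : strictly_stationary P eps.
Hypothesis q02 : 0 < q < 2.
Hypothesis C2 : condC2 P eps q.

Lemma beta_q_gt0 : 0 < beta_q q.
Proof. by have /andP[q0 q2] := q02; rewrite divr_gt0 ?mulr_gt0// subr_gt0. Qed.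

Lemma condC2_all_moments i : all_moments P (eps i).
Proof.
apply: stationary_all_moments => //.
by case: C2 => L _; exact: orlicz_all_moments beta_q_gt0 _ L.
Qed.

Lemma orlicz_norm_ge0 beta (Z : T -> R) : (0 <= orlicz_norm P beta Z)%E.
Proof. by apply: le_ereal_inf_tmp => _ [c [c0 _] <-]; rewrite lee_fin ltW. Qed.

(** Turns the extended-valued sum of (C2) into a uniform bound for finite real sums. *)
Lemma sum_fine_le_esum (I : choiceType) (D : set I) (f : I -> \bar R) s :
  (forall i, D i -> 0 <= f i)%E -> (\esum_(i in D) f i < +oo)%E ->
  uniq s -> (forall i, i \in s -> D i) ->
  (forall i, i \in s -> f i < +oo)%E /\ \sum_(i <- s) fine (f i) <= fine (\esum_(i in D) f i)%E.
Proof.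
move=> f0 Dfin us sD.
have le : (\sum_(i <- s) f i <= \esum_(i in D) f i)%E.
  apply: esum_ge; exists [set` s]; last by rewrite fsbig_seq.
  by split=> // i; exact: sD.
have ffin i : i \in s -> (f i < +oo)%E.
  move=> si; apply: le_lt_trans Dfin; apply: le_trans le.
  rewrite (perm_big _ (perm_to_rem si)) big_cons leeDl//.
  by rewrite big_seq sume_ge0// => j /mem_rem/sD; exact: f0.
have f0s i : i \in s -> (0 <= f i)%E by move=> /sD; exact: f0.
split=> //; rewrite -lee_fin fineK; last first.
  by rewrite ge0_fin_numE// esum_ge0.
apply: le_trans le; rewrite -sumEFin big_seq [leRHS]big_seq.
by apply: lee_sum => i si; rewrite fineK// ge0_fin_numE ?ffin ?f0s.
Qed.

(** The square roots in (C2) fit even moments: the moment of order m of eps_k E_|k|(eps_0) is the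
    one of order 2m of [Z k]. So [al k] is [orlicz_factor] times the squared Orlicz norm, and these
    are summable. *)
Lemma condC2_moment_bound : exists2 C : R, 0 < C &
  forall n (a : ('I_d -> int) -> R) s, uniq s -> (forall j, `|a j| <= 1) ->
  \int[P]_w ((\sum_(j <- s) a j * eps j w) ^+ n.+1.*2) <=
    (C * n.+1%:R `^ (2 / q) * (size s)%:R) ^+ n.+1.
Proof.
have b0 := beta_q_gt0; case: C2 => L0 [Em [cEm]].
set Z := fun k w => Num.sqrt `|eps k w * Em (zdist k (@zzero d)) w|.
set N := fun k => orlicz_norm P (beta_q q) (Z k).
rewrite -/(\esum_(k in _) _)%E => sumfin.
pose N0 := orlicz_norm P (beta_q q) (eps (@zzero d)).
pose Sg := fine (\esum_(k in Vset 1 (@zzero d)) (N k * N k))%E.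
have NN0 k : (0 <= N k * N k)%E by rewrite mule_ge0// orlicz_norm_ge0.
have Sg0 : 0 <= Sg by apply/fine_ge0/esum_ge0.
have sumN s : uniq s -> (forall k, k \in s -> Vset 1 (@zzero d) k) ->
    (forall i, i \in s -> N i * N i < +oo)%E /\ \sum_(i <- s) fine (N i * N i)%E <= Sg.
  by move=> us sV; apply: sum_fine_le_esum.
have Nfin k : Vset 1 (@zzero d) k -> (N k < +oo)%E.
  move=> kV; have [/(_ k (mem_head _ _)) + _] := sumN [:: k] isT (fun j => ltac:(by rewrite inE => /eqP->)).
  have := orlicz_norm_ge0 (beta_q q) (Z k); rewrite -/(N k).
  by case: (N k) => [r| |]//= _; rewrite ?ltry// mulyy.
have k1 k : Vset 1 (@zzero d) k -> (1 <= zdist k (@zzero d))%N by rewrite zdistC => -[].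
have mE k : Vset 1 (@zzero d) k -> measurable_fun setT (fun w => eps k w * Em (zdist k (@zzero d)) w).
  move=> /k1/cEm[_ iE _]; apply: measurable_funM => //.
  exact/measurable_EFinP/(measurable_int P).
have mZ k : Vset 1 (@zzero d) k -> measurable_fun setT (Z k).
  move=> /mE mk; apply: (@measurableT_comp _ _ _ _ _ _ (@Num.sqrt R)).
    exact: (continuous_measurable_fun (@sqrt_continuous R)).
  exact: measurableT_comp.
have sqZ k w : Z k w ^+ 2 = `|eps k w * Em (zdist k (@zzero d)) w| by rewrite sqr_sqrtr.
pose r0 := fine N0; pose C1 := (2 / beta_q q) `^ (2 / beta_q q) * psi_const (beta_q q).
have psi0 : 0 < psi_const (beta_q q) by rewrite ltr_wpDr// expR_ge0.
have C10 : 0 < C1 by rewrite mulr_gt0// powR_gt0// divr_gt0.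
have e2 : 0 <= expR 2 :> R by exact: expR_ge0.
(* The [1] keeps the value chosen for [al0] positive even if the errors vanish. *)
exists ((28 + 8 * expR 2) * (C1 * (r0 ^+ 2 + 1 + Sg))).
  apply: mulr_gt0; first by lra.
  by apply: mulr_gt0 => //; have := sqr_ge0 r0; lra.
move=> n a s us a1.
have LE : orlicz_factor (beta_q q) n = n.+1%:R `^ (2 / beta_q q) * C1.
  rewrite /orlicz_factor -muln2 natrM -mulrA powRM ?mulr_ge0 ?invr_ge0 ?(ltW b0)//.
  by rewrite mulrA.
have LF0 : 0 < orlicz_factor (beta_q q) n by rewrite LE mulr_gt0 ?powR_gt0.
pose al k := if `[< Vset 1 (@zzero d) k >] then orlicz_factor (beta_q q) n * fine (N k) ^+ 2 else 0.
have H := @moment_inequality R dT T d P eps Em n (orlicz_factor (beta_q q) n * (r0 ^+ 2 + 1))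
  (orlicz_factor (beta_q q) n * (r0 ^+ 2 + 1 + Sg)) al measurable_eps stationary_eps
  (condC2_all_moments _) cEm.
apply: le_trans (H _ _ _ _ _ _ a s us a1) _ => {H}.
- move=> k kV; apply: all_moments_le (mE k kV) (all_momentsX 2 (orlicz_all_moments b0 (mZ k kV) (Nfin k kV))) _.
  by move=> w; rewrite sqZ.
- by move=> k; rewrite /al; case: ifP => // _; rewrite mulr_ge0 ?sqr_ge0 ?ltW.
- move=> k kV; rewrite /al asboolT//.
  under eq_Rintegral do rewrite -sqZ -exprM mul2n.
  exact: orlicz_moment_le (mZ k kV) (Nfin k kV).
- by rewrite mulr_gt0//; have := sqr_ge0 r0; lra.
- apply: le_trans (orlicz_moment_le _ b0 (measurable_eps _) L0) _.
  have p0 := sqr_ge0 r0.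
  have l1 := ltW LF0; have l2 : r0 ^+ 2 <= r0 ^+ 2 + 1 by lra.
  rewrite lerXn2r ?nnegrE//; [by rewrite mulr_ge0| |by rewrite ler_wpM2l].
  by rewrite mulr_ge0// (le_trans p0).
- move=> t ut tV; have [_ tS] := sumN t ut tV.
  rewrite [X in _ <= X]mulrDr lerD2l big_seq.
  rewrite (eq_bigr (fun k => orlicz_factor (beta_q q) n * fine (N k * N k)%E)); last first.
    move=> k /tV kV; rewrite /al asboolT// expr2 fineM// ge0_fin_numE ?Nfin//; exact: orlicz_norm_ge0.
  by rewrite -big_seq -mulr_sumr ler_wpM2l// ltW.
- have /andP[q0 q2] := q02.
  have -> : 2 / q = 1 + 2 / beta_q q.
    by rewrite /beta_q; field; rewrite subr_eq0 !gt_eqF.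
  rewrite powRD ?pnatr_eq0 ?implybT// powRr1// LE le_eqVlt; apply/orP; left; apply/eqP.
  by congr (_ ^+ _); ring.
Qed.

End MomentBound.

(** * The maximum norm *)

Section Supnorm.
Context {R : realType} {d : nat}.
Implicit Types x y : 'I_d -> R.

Lemma supnorm_leP x r : 0 <= r -> reflect (forall l, `|x l| <= r) (supnorm x <= r).
Proof.
move=> r0; apply: (iffP idP) => [xr l|H].
  by apply: le_trans xr; exact: (le_bigmax _ (fun l => `|x l|)).
by apply: bigmax_le.
Qed.

Lemma supnorm_cube11 x : supnorm x <= 1 -> x \in @cube11 R d.
Proof. by move=> /(supnorm_leP x ler01) x1; rewrite inE => l; rewrite -ler_norml. Qed.

End Supnorm.

(** * Kernel weights and active grid points *)

Section Weights.
Context {R : realType} {d : nat}.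
Variables (K : ('I_d -> R) -> R) (c C eta : R).
Hypothesis K_ge0 : forall x, 0 <= K x.
Hypothesis K_supp : forall x, 1 < supnorm x -> K x = 0.
Hypothesis eta_gt0 : 0 < eta.
Hypothesis K_lip : forall x y, x \in @cube11 R d -> y \in @cube11 R d ->
  `|K x - K y| <= eta * supnorm (fun l => x l - y l).
Hypothesis c_gt0 : 0 < c.
Hypothesis C_gt0 : 0 < C.
Hypothesis K_bounds : forall x, x \in @cube11 R d -> c <= K x <= C.
Variables (n : nat) (h : R).
Hypothesis h_gt0 : 0 < h.
Implicit Types (x y : 'I_d -> R) (f : {ffun 'I_d -> 'I_n}).

Definition scaled x f : 'I_d -> R := fun l => (x l - gridpt f l) / h.

(** On this set the kernel is Lipschitz with values between [c] and [C], off it the kernel vanishes;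
    its jumps are seen only when the set changes. *)
Definition active x : {set {ffun 'I_d -> 'I_n}} := [set f | supnorm (scaled x f) <= 1].

Definition weight x f : R := K (scaled x f) / \sum_f' K (scaled x f').

Lemma activeP x f : reflect (forall l, `|x l - gridpt f l| <= h) (f \in active x).
Proof.
rewrite inE; apply: (iffP (supnorm_leP _ ler01)) => H l; have := H l;
  by rewrite normrM normfV (gtr0_norm h_gt0) ler_pdivrMr// mul1r.
Qed.

Lemma K_active x f : f \in active x -> c <= K (scaled x f) <= C.
Proof. by rewrite inE => /supnorm_cube11; exact: K_bounds. Qed.

Lemma K_inactive x f : f \notin active x -> K (scaled x f) = 0.
Proof. by rewrite inE -ltNge; exact: K_supp. Qed.

Lemma weight_inactive x f : f \notin active x -> weight x f = 0.
Proof. by move=> /K_inactive fx; rewrite /weight fx mul0r. Qed.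

Lemma sum_K_ge x : c * #|active x|%:R <= \sum_f K (scaled x f).
Proof.
rewrite (bigID (mem (active x)))/= [X in _ <= _ + X]big1 ?addr0; last first.
  by move=> f; exact: K_inactive.
rewrite mulr_natr -sumr_const; apply: ler_sum => f fx.
by have /andP[] := K_active fx.
Qed.

Lemma weight_le x f : (0 < #|active x|)%N ->
  `|weight x f| <= C / (c * #|active x|%:R).
Proof.
move=> cx; have cc : 0 < c * #|active x|%:R by rewrite mulr_gt0// ltr0n.
have den := sum_K_ge x; have den0 := lt_le_trans cc den.
have [fx|fx] := boolP (f \in active x); last first.
  by rewrite weight_inactive// normr0 divr_ge0// ltW.
rewrite /weight ger0_norm; last by rewrite divr_ge0// ltW.
have /andP[_ KC] := K_active fx.
by rewrite ler_pM ?invr_ge0 ?(ltW den0)// lef_pV2.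
Qed.

(** Each active kernel value moves by at most [kap], and their sum, which is at least [c * m], by at
    most [kap * m]. So a weight moves by [kap / (c * m)] through its numerator and by
    [C * kap / (c ^ 2 * m)] through its denominator, and [m] weights count. *)
Lemma sum_weight_diff x y delta (e : {ffun 'I_d -> 'I_n} -> R) M :
  active x = active y -> (0 < #|active x|)%N -> 0 <= delta ->
  (forall l, `|x l - y l| <= delta) -> (forall f, `|e f| <= M) ->
  `|\sum_f weight x f * e f - \sum_f weight y f * e f| <=
    eta * (delta / h) * (c^-1 + C / c ^+ 2) * M.
Proof.
move=> xy cx delta0 xyd eM; set m := #|active x| in cx.
have m0 : (0 : R) < m%:R by rewrite ltr0n.
pose kap := eta * (delta / h).
have kap0 : 0 <= kap by rewrite mulr_ge0 ?divr_ge0 ?(ltW h_gt0) ?(ltW eta_gt0).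
have KK f : f \in active x -> `|K (scaled x f) - K (scaled y f)| <= kap.
  move=> fx; have fy : f \in active y by rewrite -xy.
  move: fx fy; rewrite !inE => /supnorm_cube11 fx /supnorm_cube11 fy.
  apply: le_trans (K_lip fx fy) _; rewrite ler_wpM2l ?(ltW eta_gt0)//.
  apply/supnorm_leP; first by rewrite divr_ge0// ltW.
  move=> l; rewrite /scaled -mulrBl normrM normfV (gtr0_norm h_gt0).
  by rewrite ler_wpM2r ?invr_ge0 ?(ltW h_gt0)// opprB addrA subrK.
have sumE z : active x = active z -> \sum_f K (scaled z f) = \sum_(f in active x) K (scaled z f).
  move=> xz; rewrite (bigID (mem (active x)))/= [X in _ + X]big1 ?addr0// => f.
  by rewrite xz; exact: K_inactive.
set D := \sum_f K (scaled x f); set D' := \sum_f K (scaled y f).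
have cm0 : 0 < c * m%:R by rewrite mulr_gt0.
have Dge : c * m%:R <= D by exact: sum_K_ge.
have D'ge : c * m%:R <= D' by rewrite /m xy; exact: sum_K_ge.
have D0 := lt_le_trans cm0 Dge; have D'0 := lt_le_trans cm0 D'ge.
have DD : `|D - D'| <= kap * m%:R.
  rewrite /D /D' (sumE x)// (sumE y)// -sumrB (le_trans (ler_norm_sum _ _ _))//.
  by rewrite mulr_natr -sumr_const; exact: ler_sum.
have W f : f \in active x ->
    `|weight x f - weight y f| <= kap * (c^-1 + C / c ^+ 2) / m%:R.
  move=> fx; have fy : f \in active y by rewrite -xy.
  have /andP[_ KC] := K_active fy.
  have -> : weight x f - weight y f =
      (K (scaled x f) - K (scaled y f)) / D + K (scaled y f) * ((D' - D) / (D * D')).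
    by rewrite /weight -/D -/D'; field; rewrite !gt_eqF.
  apply: (le_trans (ler_normD _ _)).
  have -> : kap * (c^-1 + C / c ^+ 2) / m%:R =
      kap / (c * m%:R) + C * ((kap * m%:R) / ((c * m%:R) * (c * m%:R))).
    by field; rewrite !gt_eqF.
  apply: lerD.
    rewrite normrM normfV (gtr0_norm D0) ler_pM ?invr_ge0 ?(ltW D0) ?KK//.
    by rewrite lef_pV2.
  rewrite normrM (ger0_norm (K_ge0 _)); apply: ler_pM => //.
  rewrite normrM normfV distrC (gtr0_norm (mulr_gt0 D0 D'0)).
  have cm1 := ltW cm0; have DD0 : 0 <= D * D' by rewrite mulr_ge0// ltW.
  apply: ler_pM => //; first by rewrite invr_ge0.
  by rewrite lef_pV2 ?posrE ?mulr_gt0// ler_pM.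
rewrite -sumrB (bigID (mem (active x)))/= [X in _ + X]big1 ?addr0; last first.
  by move=> f fx; rewrite !weight_inactive ?mul0r ?subrr// -xy.
apply: (le_trans (ler_norm_sum _ _ _)).
apply: (@le_trans _ _ (\sum_(f in active x) (kap * (c^-1 + C / c ^+ 2) / m%:R * M))).
  by apply: ler_sum => f fx; rewrite -mulrBl normrM ler_pM// W.
rewrite sumr_const -/m -[leLHS]mulr_natr le_eqVlt; apply/orP; left; apply/eqP.
by rewrite /kap; field; rewrite !gt_eqF.
Qed.

(* In each coordinate, [k] consecutive grid points starting just above [n * x l], pushed left if
   they would leave the grid. *)
Lemma active_card x (k := Num.truncn (n%:R * h)) : h <= 1 -> x \in @cube01 R d ->
  (k ^ d <= #|active x|)%N.
Proof.
rewrite inE => h1 x01.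
have nh0 : 0 <= n%:R * h by rewrite mulr_ge0// ltW.
have /andP[kle _] := truncn_itv nh0; rewrite -/k in kle.
have kn : (k <= n)%N.
  by rewrite -(ler_nat R) (le_trans kle)// ler_piMr.
pose b l := minn (Num.truncn (n%:R * x l)) (n - k).
have lt_n l (r : 'I_k) : (b l + r < n)%N.
  have := ltn_ord r; have := geq_minr (Num.truncn (n%:R * x l)) (n - k); rewrite -/(b l).
  by move: kn; lia.
pose F (r : {ffun 'I_d -> 'I_k}) : {ffun 'I_d -> 'I_n} := [ffun l => Ordinal (lt_n l (r l))].
have Finj : injective F.
  move=> r r' /ffunP e; apply/ffunP => l; apply/val_inj.
  by have := congr1 val (e l); rewrite !ffunE /= => /addnI.
have -> : (k ^ d)%N = #|codom F| by rewrite card_codom// card_ffun !card_ord.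
apply: fintype.subset_leq_card; apply/fintype.subsetP => _ /codomP[r ->]; apply/activeP => l.
have /andP[x0 x1] := x01 l.
have n0 : (0 < n)%N by exact: leq_ltn_trans (lt_n l (r l)).
have nR : (0 : R) < n%:R by rewrite ltr0n.
rewrite -(ler_pM2l nR) -[X in X * _ <= _](gtr0_norm nR) -normrM mulrBr /gridpt ffunE/=.
rewrite [n%:R * (_ / _)]mulrC divfK ?gt_eqF//.
have nx0 : 0 <= n%:R * x l by rewrite mulr_ge0.
have nx1 : n%:R * x l <= n%:R by rewrite ler_piMr.
have /andP[t1 t2] := truncn_itv nx0.
set t := Num.truncn (n%:R * x l) in t1 t2.
have rk : ((r l).+1%:R : R) <= k%:R by rewrite ler_nat.
have r0 : (0 : R) <= (r l)%:R by [].
rewrite -addnS natrD ler_norml.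
have [tk|tk] := leqP t (n - k).
  rewrite /b -/t (minn_idPl tk); move: t2 rk; rewrite -!natr1; lra.
have -> : b l = (n - k)%N by rewrite /b -/t; apply/minn_idPr; exact: ltnW.
have tkR : (n%:R : R) <= t%:R + k%:R by rewrite -natrD ler_nat addnC -leq_subLR ltnW.
rewrite natrB//; move: rk; rewrite -!natr1; lra.
Qed.

End Weights.

(** * Cells with a constant active set *)

Section Signature.
Context {R : realType} {d : nat}.
Variables (n N : nat) (h : R).
Hypothesis h_gt0 : 0 < h.
Hypothesis h_le1 : h <= 1.

(** Bounds all three truncations below, the largest being that of n (2 - x + h) <= 3n or of N x <=
    N, so that [inord] loses nothing. *)
Let Q := (3 * n + N)%N.

Definition signature_type : finType := {ffun 'I_d -> 'I_Q.+1 * 'I_Q.+1 * 'I_Q.+1}.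

(* The first two entries determine the active set, the third one locates [x] up to [1 / N]. *)
Definition signature (x : 'I_d -> R) : signature_type :=
  [ffun l => (inord (Num.truncn (n%:R * (x l + h))),
              inord (Num.truncn (n%:R * (2 - x l + h))), inord (Num.truncn (N%:R * x l)))].

Lemma card_signature_type : #|signature_type| = ((3 * n + N).+1 ^ (3 * d))%N.
Proof. by rewrite card_ffun !card_prod !card_ord expnM !expnS expn0 muln1 mulnA. Qed.

(** For a grid index i the condition |x - i/n| <= h means i <= n (x + h) and 2n - i <= n (2 - x +
    h). The left sides are natural numbers, so only the integer parts of the right sides matter. *)
Lemma signatureP x y : (0 < n)%N -> (0 < N)%N ->
  x \in @cube01 R d -> y \in @cube01 R d -> signature x = signature y ->
  active n h x = active n h y /\ forall l, `|x l - y l| <= N%:R^-1.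
Proof.
move=> n0 N0; rewrite !inE => x01 y01 /ffunP xy.
have nR : (0 : R) < n%:R by rewrite ltr0n.
have NR : (0 : R) < N%:R by rewrite ltr0n.
have inord_inj (a b : R) : 0 <= a -> a <= Q%:R -> 0 <= b -> b <= Q%:R ->
    inord (Num.truncn a) = inord (Num.truncn b) :> 'I_Q.+1 -> Num.truncn a = Num.truncn b.
  move=> a0 aQ b0 bQ /(congr1 val) /=; rewrite !inordK// ltnS -(ler_nat R).
    by rewrite (le_trans _ bQ)// truncn_le.
  by rewrite (le_trans _ aQ)// truncn_le.
have QE : Q%:R = 3 * n%:R + N%:R :> R by rewrite natrD natrM.
have sig (z : 'I_d -> R) l : cube01 z ->
    [/\ 0 <= n%:R * (z l + h) <= Q%:R, 0 <= n%:R * (2 - z l + h) <= Q%:R &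
        0 <= N%:R * z l <= Q%:R].
  move=> /(_ l) /andP[z0 z1]; rewrite QE; have := ltW h_gt0; have := h_le1.
  move=> h1 h0; have nR0 := ltW nR; have NR0 := ltW NR.
  have nz1 : n%:R * z l <= n%:R by rewrite ler_piMr.
  have nh1 : n%:R * h <= n%:R by rewrite ler_piMr.
  have Nz1 : N%:R * z l <= N%:R by rewrite ler_piMr.
  have nz0 : 0 <= n%:R * z l by rewrite mulr_ge0.
  have nh0 : 0 <= n%:R * h by rewrite mulr_ge0.
  have Nz0 : 0 <= N%:R * z l by rewrite mulr_ge0.
  by split; apply/andP; split; rewrite ?mulrDr ?mulrN; lra.
have trunc_eq l : [/\ Num.truncn (n%:R * (x l + h)) = Num.truncn (n%:R * (y l + h)),
    Num.truncn (n%:R * (2 - x l + h)) = Num.truncn (n%:R * (2 - y l + h)) &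
    Num.truncn (N%:R * x l) = Num.truncn (N%:R * y l)].
  have := xy l; rewrite !ffunE => -[e1 e2 e3].
  have [/andP[a1 a2] /andP[b1 b2] /andP[c1 c2]] := sig x l x01.
  have [/andP[a3 a4] /andP[b3 b4] /andP[c3 c4]] := sig y l y01.
  by split; apply: inord_inj.
split=> [|l]; last first.
  have [_ _ e] := trunc_eq l.
  have [_ _ /andP[c1 _]] := sig x l x01; have [_ _ /andP[c3 _]] := sig y l y01.
  have /andP[] := truncn_itv c1; have /andP[] := truncn_itv c3; rewrite e -natr1.
  move: (Num.truncn _)%:R => t t1 t2 t3 t4.
  rewrite -(ler_pM2l NR) mulfV ?gt_eqF// -[X in X * _ <= _](gtr0_norm NR) -normrM mulrBr.
  by rewrite ler_norml; lra.
have actE (z : 'I_d -> R) f : cube01 z -> (f \in active n h z) =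
    [forall l, ((f l).+1 <= Num.truncn (n%:R * (z l + h)))%N &&
               (2 * n - (f l).+1 <= Num.truncn (n%:R * (2 - z l + h)))%N].
  move=> z01; have step l : (`|z l - gridpt f l| <= h) =
      ((f l).+1 <= Num.truncn (n%:R * (z l + h)))%N &&
      (2 * n - (f l).+1 <= Num.truncn (n%:R * (2 - z l + h)))%N.
    have [/andP[a1 _] /andP[b1 _] _] := sig z l z01; rewrite !truncn_ge_nat//.
    have f2n : ((f l).+1 <= 2 * n)%N by rewrite (leq_trans (ltn_ord _))// leq_pmull.
    rewrite natrB// natrM -(ler_pM2l nR) -[X in X * `|_|](gtr0_norm nR) -normrM mulrBr /gridpt.
    rewrite [n%:R * (_ / _)]mulrC divfK ?gt_eqF// ler_norml !mulrDr mulrN.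
    move: (n%:R * z l) (n%:R * h) (f l).+1%:R (n%:R : R) => u v w t.
    by apply/andP/andP => -[H1 H2]; split; lra.
  apply/(sameP (activeP h_gt0 z f))/(iffP forallP) => H l; have := H l; by rewrite step.
by apply/setP => f; rewrite !actE//; apply: eq_forallb => l; have [-> -> _] := trunc_eq l.
Qed.

End Signature.

(** * Markov's inequality, union bound and Borel-Cantelli *)

Section ProbabilityTools.
Context {R : realType} {dT : measure_display} {T : measurableType dT}.
Variable P : probability T R.

Lemma markov_even_moment (X : T -> R) n (lam : R) : all_moments P X -> 0 < lam ->
  (P [set w | (lam <= `|X w|)%R] <= ((\int[P]_w (X w ^+ n.+1.*2))%R / lam ^+ n.+1.*2)%:E)%E.
Proof.
move=> aX lam0; have [mX iX] := aX.
have L0 : 0 < lam ^+ n.+1.*2 by rewrite exprn_gt0.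
have := le_integral_abse P measurableT (g := EFin \o (fun w => X w ^+ n.+1.*2))
  (a := lam ^+ n.+1.*2) (measurable_int P (iX n.+1.*2)) L0.
rewrite setTI.
have -> : [set w | ((lam ^+ n.+1.*2)%:E <= `|(EFin \o (fun w => X w ^+ n.+1.*2)%R) w|)%E] =
    [set w | (lam <= `|X w|)%R].
  apply/seteqP; split=> w /=; rewrite lee_fin normrX.
    by rewrite ler_pXn2r// ?nnegrE// ltW.
  by move=> H; rewrite lerXn2r// nnegrE// ltW.
move=> H; rewrite mulrC EFinM lee_pdivlMl//; apply: le_trans H _.
under eq_integral do rewrite /= ger0_norm ?exprn_double_ge0//.
by rewrite /Rintegral fineK//; exact: (integrable_fin_num measurableT (iX _)).
Qed.

Lemma finType_union_le (I : finType) (F : I -> set T) (B : R) :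
  (forall i, measurable (F i)) -> (forall i, P (F i) <= B%:E)%E ->
  (P (\bigcup_i F i) <= (#|I|%:R * B)%:E)%E.
Proof.
move=> mF FB.
have H (s : seq I) : (P (\big[setU/set0]_(i <- s) F i) <= ((size s)%:R * B)%:E)%E.
  elim: s => [|i s IH]; first by rewrite big_nil measure0 mul0r.
  rewrite big_cons (le_trans (measureU2 _ _ _))//; first exact: bigsetU_measurable.
  by rewrite /= -natr1 mulrDl mul1r addrC EFinD leeD.
have := H (enum I); rewrite -bigcup_seq -cardE.
by rewrite (_ : [set` enum I] = setT)//; apply/seteqP; split=> // i _; rewrite /= mem_enum.
Qed.

(* [1 / n^2 <= 2 (1 / n - 1 / n.+1)] makes the bound summable by telescoping. *)
Lemma borel_cantelli_inv_sqr (F : nat -> set T) (B : R) n0 :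
  (forall n, measurable (F n)) ->
  (forall n, (n0 <= n)%N -> (P (F n) <= (B / n%:R ^+ 2)%:E)%E) ->
  {ae P, forall w, \forall n \near \oo, ~ F n w}.
Proof.
(* The shift skips the indices without a bound, and the index [0], where the inverse has no
   meaning. *)
move=> mF FB; pose k := n0.+1.
pose G n := F (n + k)%N.
have B0 : 0 <= B.
  have /(le_trans (measure_ge0 _ _)) := FB k (leqnSn _).
  by rewrite lee_fin pmulr_lge0// invr_gt0 exprn_gt0.
have GB n : (P (G n) <= (2 * B * ((n + k)%:R^-1 - (n + k).+1%:R^-1))%:E)%E.
  rewrite (le_trans (FB _ _))//; first by rewrite /k addnS ltnW// ltnS leq_addl.
  rewrite lee_fin /k addnS; set m : R := (n + n0).+1%:R.
  have m1 : 1 <= m by rewrite ler1n.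
  have -> : (n + n0).+2%:R = m + 1 :> R by rewrite natr1.
  have -> : 2 * B * (m^-1 - (m + 1)^-1) = B * (2 / (m * (m + 1))).
    by field; rewrite !gt_eqF//; lra.
  rewrite ler_wpM2l// ler_pdivlMr; last by nra.
  by rewrite mulrC ler_pdivrMr; nra.
have mG n : measurable (G n) by exact: mF.
have sumG : (\sum_(n <oo) P (G n) < +oo)%E.
  apply: (@le_lt_trans _ _ (2 * B)%:E); last exact: ltry.
  apply: lime_le; first by apply: is_cvg_nneseries => n _ _; exact: measure_ge0.
  apply: nearW => N.
  apply: (@le_trans _ _ (2 * B * (k%:R^-1 - (N + k)%:R^-1))%:E).
    elim: N => [|N IH]; first by rewrite big_nil add0n subrr mulr0.
    rewrite big_nat_recr//= (le_trans (leeD IH (GB N)))//.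
    by rewrite -EFinD -mulrDr lee_fin addrA subrK addSn.
  rewrite lee_fin -[leRHS]mulr1 ler_wpM2l ?mulr_ge0//.
  have : (k%:R^-1 : R) <= 1 by rewrite invf_le1// ler1n.
  by have : (0 : R) <= (N + k)%:R^-1 by []; lra.
have G0 := lim_sup_set_cvg0 mG sumG.
exists (lim_sup_set G); split=> //.
  by apply: bigcap_measurable => // m _; apply: bigcup_measurable.
move=> w /= H m _; apply: contrapT => no; apply: H.
exists (m + k)%N => // j /= mj Fj; apply: no.
have kj : (k <= j)%N := leq_trans (leq_addl m k) mj.
by exists (j - k)%N; rewrite /= ?leq_subRL// 1?addnC// /G subnK.
Qed.

Lemma limn_esup_le (u : nat -> \bar R) (L : \bar R) :
  (\forall n \near \oo, u n <= L)%E -> (limn_esup u <= L)%E.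
Proof.
move=> uL; apply: (@le_trans _ _ (ereal_sup (u @` [set n | (u n <= L)%E]))).
  by apply: ereal_inf_lbound; exists [set n | (u n <= L)%E].
by apply: ge_ereal_sup => _ [n un <-].
Qed.

End ProbabilityTools.

(** * The centred estimator as a linear form in the errors *)

Section Deviation.
Context {R : realType} {dT : measure_display} {T : measurableType dT} {d : nat}.
Variables (P : probability T R) (eps : ('I_d -> int) -> T -> R).
Variables (K : ('I_d -> R) -> R) (c C : R).
Hypothesis moments_eps : forall i, all_moments P (eps i).
Hypothesis K_ge0 : forall x, 0 <= K x.
Hypothesis K_supp : forall x, 1 < supnorm x -> K x = 0.
Hypothesis c_gt0 : 0 < c.
Hypothesis C_gt0 : 0 < C.
Hypothesis K_bounds : forall x, x \in @cube11 R d -> c <= K x <= C.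

Definition deviation n (h : R) (x : 'I_d -> R) (w : T) : R :=
  \sum_(f : {ffun 'I_d -> 'I_n}) weight K h x f * eps (gridix f) w.

Lemma all_moments_deviation n h x : all_moments P (@deviation n h x).
Proof. by apply: all_moments_sum => f _; exact: all_momentsZ. Qed.

(** The regression function contributes a constant, which cancels with the mean. *)
Lemma gn_centered (g : ('I_d -> R) -> R) (h : nat -> R) n x w :
  (forall i, \int[P]_w (eps i w) = 0) ->
  gn K g eps h n x w - fine ('E_P[gn K g eps h n x])%E = deviation n (h n) x w.
Proof.
move=> E0.
have gE w' : gn K g eps h n x w' =
    \sum_(f : {ffun 'I_d -> 'I_n}) weight K (h n) x f * g (gridpt f) + deviation n (h n) x w'.
  rewrite /gn /deviation -big_split/= mulr_suml; apply: eq_bigr => f _.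
  by rewrite -mulrDr [RHS]mulrC mulrA.
have -> : fine ('E_P[gn K g eps h n x])%E = \int[P]_w gn K g eps h n x w by rewrite unlock.
rewrite gE; under eq_Rintegral do rewrite gE.
rewrite all_moments_RintegralD; last 2 first.
- exact: all_moments_cst.
- exact: all_moments_deviation.
have -> r : \int[P]_w r = r.
  rewrite Rintegral_cst// -[RHS]mulr1; congr (_ * _).
  by rewrite -[RHS]/(fine 1%E); congr fine; exact: probability_setT.
rewrite /deviation all_moments_Rintegral_sum; last first.
  by move=> f _; exact: all_momentsZ.
rewrite [X in _ - (_ + X)]big1 ?addr0; first by rewrite addrC addKr.
by move=> f _; rewrite all_moments_RintegralZ// E0 mulr0.
Qed.

Lemma gridix_inj n : injective (@gridix d n).
Proof.
move=> f f' e; apply/ffunP => l; apply/val_inj.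
by have /(congr1 (fun k => k l)) := e; rewrite /gridix => -[].
Qed.

(** Dividing by the uniform bound [A] brings the weights below 1, only the [m] active points count,
    and [A ^ 2 * m] equals [(C / c) ^ 2 / m]. *)
Lemma deviation_moment (C' beta h : R) n k x : 0 < h -> 0 < C' ->
  (forall n' (a : ('I_d -> int) -> R) s, uniq s -> (forall j, `|a j| <= 1) ->
    \int[P]_w ((\sum_(j <- s) a j * eps j w) ^+ n'.+1.*2) <=
      (C' * n'.+1%:R `^ beta * (size s)%:R) ^+ n'.+1) ->
  (0 < #|active n h x|)%N ->
  \int[P]_w (deviation n h x w ^+ k.+1.*2) <=
    ((C / c) ^+ 2 * C' * k.+1%:R `^ beta / #|active n h x|%:R) ^+ k.+1.
Proof.
move=> h0 C'0 HC cx; set m := #|active n h x| in cx *.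
have mR : (0 : R) < m%:R by rewrite ltr0n.
pose A := C / (c * m%:R).
have A0 : 0 < A by rewrite divr_gt0// mulr_gt0.
(* The moment bound asks for weights on the whole lattice: those of the grid are transported by the
   injection [gridix], the others are [0]. *)
pose a j := if [pick f : {ffun 'I_d -> 'I_n} | gridix f == j] is Some f then weight K h x f / A else 0.
have aE (f : {ffun 'I_d -> 'I_n}) : a (gridix f) = weight K h x f / A.
  rewrite /a; case: pickP => [f' /eqP e|/(_ f)]; last by rewrite eqxx.
  by rewrite (gridix_inj e).
have a1 j : `|a j| <= 1.
  rewrite /a; case: pickP => [f _|_]; last by rewrite normr0.
  rewrite normrM normfV (gtr0_norm A0) ler_pdivrMr// mul1r.
  exact: weight_le.
pose s := [seq gridix f | f <- enum (active n h x)].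
have us : uniq s by rewrite map_inj_uniq ?enum_uniq//; exact: gridix_inj.
have ss : size s = m by rewrite size_map -cardE.
have dE w : deviation n h x w = A * \sum_(j <- s) a j * eps j w.
  rewrite /deviation (bigID (mem (active n h x)))/= [X in _ + X]big1 ?addr0; last first.
    by move=> f fx; rewrite (weight_inactive K_supp)// mul0r.
  rewrite /s big_map big_enum/= mulr_sumr; apply: eq_bigr => f _.
  by rewrite aE mulrA mulrCA divff ?gt_eqF// mulr1.
under eq_Rintegral do rewrite dE exprMn.
rewrite all_moments_RintegralZ; last first.
  by apply: all_momentsX; apply: all_moments_sum => j _; exact: all_momentsZ.
apply: (@le_trans _ _ (A ^+ k.+1.*2 * (C' * k.+1%:R `^ beta * m%:R) ^+ k.+1)).
  by rewrite ler_wpM2l ?exprn_double_ge0// -ss; exact: HC.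
rewrite -mul2n exprM -exprMn le_eqVlt; apply/orP; left; apply/eqP; congr (_ ^+ _).
by rewrite /A; field; rewrite !gt_eqF.
Qed.

End Deviation.

(** * The rate of convergence *)

Section Rate.
Context {R : realType}.
Variables (d n : nat) (h q : R).
Hypothesis ln_ge1 : 1 <= ln (n%:R : R).
Hypothesis nh_ge1 : 1 <= n%:R * h.
Hypothesis h_le1 : h <= 1.
Hypothesis q_gt0 : 0 < q.

Definition rate : R := (ln n%:R) `^ (q^-1) / (n%:R * h) `^ (d%:R / 2).

Let nh_gt0 : 0 < n%:R * h.
Proof. exact: lt_le_trans ltr01 nh_ge1. Qed.

Let ln_gt0 : 0 < ln (n%:R : R).
Proof. exact: lt_le_trans ltr01 ln_ge1. Qed.

Lemma rate_gt0 : 0 < rate.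
Proof. by rewrite divr_gt0// powR_gt0. Qed.

Lemma rate_sqr : rate ^+ 2 = (ln n%:R) `^ (2 / q) / (n%:R * h) ^+ d.
Proof.
have sq (a b : R) : (a `^ b) ^+ 2 = a `^ (b * 2) by rewrite -powR_mulrn ?powR_ge0// -powRrM.
by rewrite /rate expr_div_n !sq divfK// powR_mulrn ?(ltW nh_gt0)// [q^-1 * 2]mulrC.
Qed.

(** Any error of order n^(-d), such as that of the discretization, is thereby absorbed. *)
Lemma rate_ge : (n%:R ^+ d)^-1 <= rate.
Proof.
have L1 : 1 <= (ln (n%:R : R)) `^ (q^-1).
  have {1}<- : 1 `^ q^-1 = 1 :> R by rewrite powR1.
  rewrite ge0_ler_powR ?nnegrE ?invr_ge0 ?(ltW q_gt0) ?(ltW ln_gt0)//.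
have nR : (0 : R) <= n%:R by [].
have nh0 := ltW nh_gt0.
have yd : (n%:R * h) `^ (d%:R / 2) <= n%:R ^+ d.
  apply: (@le_trans _ _ ((n%:R * h) `^ d%:R)).
    rewrite ler_powR// ler_pdivrMr// ler_peMr//; lra.
  by rewrite powR_mulrn// lerXn2r ?nnegrE// ler_piMr.
have p0 : 0 < (n%:R * h) `^ (d%:R / 2) by rewrite powR_gt0.
apply: (@le_trans _ _ ((n%:R * h) `^ (d%:R / 2))^-1).
  by rewrite lef_pV2 ?posrE// (lt_le_trans p0).
by rewrite /rate ler_peMl// invr_ge0 ltW.
Qed.

(** The integer part of a number at least 1 is at least half of it. *)
Lemma active_card_ge x : 0 < h -> x \in @cube01 R d ->
  ((n%:R * h) / 2) ^+ d <= #|active n h x|%:R.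
Proof.
move=> h0 x01; have nh0 := ltW nh_gt0.
apply: (@le_trans _ _ (Num.truncn (n%:R * h) ^ d)%:R); last first.
  by rewrite ler_nat; exact: active_card.
rewrite natrX lerXn2r ?nnegrE ?divr_ge0// ler_pdivrMr//.
have k1 : (1 : R) <= (Num.truncn (n%:R * h))%:R by rewrite ler1n truncn_gt0.
by have := truncnS_gt (n%:R * h); rewrite -natr1; lra.
Qed.

End Rate.

(** * Tail bound at one point *)

Section Tail.
Context {R : realType} {dT : measure_display} {T : measurableType dT} {d : nat}.
Variables (P : probability T R) (eps : ('I_d -> int) -> T -> R).
Variables (K : ('I_d -> R) -> R) (c C C' q : R) (kappa : nat).
Hypothesis moments_eps : forall i, all_moments P (eps i).
Hypothesis K_ge0 : forall x, 0 <= K x.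
Hypothesis K_supp : forall x, 1 < supnorm x -> K x = 0.
Hypothesis c_gt0 : 0 < c.
Hypothesis C_gt0 : 0 < C.
Hypothesis K_bounds : forall x, x \in @cube11 R d -> c <= K x <= C.
Hypothesis C'_gt0 : 0 < C'.
Hypothesis moment_bound : forall n (a : ('I_d -> int) -> R) s, uniq s -> (forall j, `|a j| <= 1) ->
  \int[P]_w ((\sum_(j <- s) a j * eps j w) ^+ n.+1.*2) <=
    (C' * n.+1%:R `^ (2 / q) * (size s)%:R) ^+ n.+1.
Hypothesis q_gt0 : 0 < q.

Let D := (C / c) ^+ 2 * C'.

(** [2 ^ (2 / q)] pays for [k.+1 <= 2 ln n], [2 ^ d] for the count of active points, and
    [expR kappa] for a gain of exp(-kappa) per unit of the moment order. The [+ 1] makes the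
    threshold at most its square, the quantity that Markov's inequality provides. *)
Definition threshold : R :=
  (C / c) ^+ 2 * C' * (2 `^ (2 / q) * 2 ^+ d) * expR kappa%:R + 1.

Lemma threshold_ge1 : 1 <= threshold.
Proof.
rewrite lerDr; apply: mulr_ge0; last exact: expR_ge0.
by apply: mulr_ge0; apply: mulr_ge0; rewrite ?sqr_ge0 ?powR_ge0 ?exprn_ge0// ltW.
Qed.

(* Markov's inequality for the moment of order about [2 ln n]. *)
Lemma deviation_tail n h x :
  1 <= ln (n%:R : R) -> 1 <= n%:R * h -> 0 < h -> h <= 1 -> x \in @cube01 R d ->
  (P [set w | (threshold * rate d n h q <= `|deviation eps K n h x w|)%R] <=
    ((n%:R ^+ kappa)^-1)%:E)%E.
Proof.
move=> L1 nh1 h0 h1 x01; set L := ln _ in L1.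
have lam1 := threshold_ge1; set lam := threshold in lam1 *.
have r0 := @rate_gt0 R d n h q L1 nh1.
have rr := @rate_sqr R d n h q nh1.
set r := rate d n h q in r0 rr *; rewrite -/L in rr.
have lam0 : 0 < lam by rewrite (lt_le_trans _ lam1).
(* Both sides of the truncation serve: [k.+1 <= 2 * L] bounds the moment, and [L < k.+1] turns
   exp(-kappa) to the power [k.+1] into at most n^(-kappa). *)
pose k := Num.truncn L.
have L0 : 0 <= L by rewrite (le_trans _ L1).
have /andP[k1 k2] := truncn_itv L0; rewrite -/k in k1 k2.
have kL : k.+1%:R <= 2 * L by rewrite -natr1; lra.
have nh0 : 0 < n%:R * h by rewrite (lt_le_trans _ nh1).
have card := active_card_ge nh1 h1 h0 x01.
have c0 : 0 < (n%:R * h / 2) ^+ d by rewrite exprn_gt0// divr_gt0.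
have card0 : (0 < #|active n h x|)%N by rewrite -(ltr_nat R) (lt_le_trans c0).
have D0 : 0 < D by rewrite mulr_gt0// exprn_gt0// divr_gt0.
have q0 : 0 <= 2 / q by rewrite divr_ge0// ltW.
apply: (le_trans (markov_even_moment k (all_moments_deviation _ moments_eps _ _ _) (mulr_gt0 lam0 r0))).
rewrite lee_fin.
have M := deviation_moment moments_eps K_ge0 K_supp c_gt0 C_gt0 K_bounds k h0 C'_gt0 moment_bound card0.
set V := Rintegral _ _ _ in M *.
have lr0 : 0 < (lam * r) ^+ 2 by rewrite exprn_gt0// mulr_gt0.
have key : D * k.+1%:R `^ (2 / q) / #|active n h x|%:R <= (lam * r) ^+ 2 * expR (- kappa%:R).
  apply: (@le_trans _ _ (D * (2 `^ (2 / q) * L `^ (2 / q)) / (n%:R * h / 2) ^+ d)).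
    apply: ler_pM.
    - by rewrite mulr_ge0 ?powR_ge0// ltW.
    - by rewrite invr_ge0.
    - rewrite ler_wpM2l ?(ltW D0)// -powRM//.
      by rewrite ge0_ler_powR ?nnegrE// mulr_ge0.
    - by rewrite lef_pV2 ?posrE// (lt_le_trans c0).
  have -> : D * (2 `^ (2 / q) * L `^ (2 / q)) / (n%:R * h / 2) ^+ d =
      D * (2 `^ (2 / q) * 2 ^+ d) * r ^+ 2.
    rewrite rr expr_div_n; field.
    by rewrite expf_neq0// gt_eqF.
  rewrite [(lam * r) ^+ 2]exprMn [leRHS]mulrAC ler_wpM2r ?sqr_ge0//.
  rewrite expRN ler_pdivlMr ?expR_gt0//.
  apply: (@le_trans _ _ lam); first by rewrite /lam /threshold -/D lerDl.
  by rewrite expr2 ler_peMr// ltW.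
have e0 : 0 <= D * k.+1%:R `^ (2 / q) / #|active n h x|%:R.
  by rewrite mulr_ge0// mulr_ge0 ?powR_ge0// ltW.
have n0 : (0 : R) < n%:R.
  by rewrite ltr0n lt0n; apply/negP => /eqP n0; move: nh0; rewrite n0 mul0r ltxx.
apply: (@le_trans _ _ (expR (- kappa%:R) ^+ k.+1)).
  rewrite -[(lam * r) ^+ _.*2]/((lam * r) ^+ k.+1.*2) -mul2n exprM ler_pdivrMr; last by rewrite exprn_gt0.
  have e1 : 0 <= expR (- kappa%:R) * (lam * r) ^+ 2.
    by apply: mulr_ge0; [exact: expR_ge0|exact: ltW].
  by rewrite (le_trans M)// -exprMn lerXn2r ?nnegrE// [leRHS]mulrC.
rewrite -expRM_natl mulrN expRN lef_pV2 ?posrE ?expR_gt0 ?exprn_gt0//.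
have -> : n%:R = expR L :> R by rewrite lnK.
rewrite -expRM_natl ler_expR mulrC ler_wpM2r// ltW//.
Qed.

End Tail.

(** * A representative point of each cell *)

Section Covering.
Context {R : realType} {d : nat}.
Variables (n N : nat) (h : R).

(* The default [0] lies in the cube, so that [representative s] does so whether or not [s] is attained. *)
Definition representative (s : signature_type (d := d) n N) : 'I_d -> R :=
  if pselect (exists x, cube01 x /\ signature n N h x = s) is left e then projT1 (cid e)
  else fun=> 0.

Lemma representative_cube s : representative s \in @cube01 R d.
Proof.
rewrite inE /representative; case: pselect => [e|_]; first by case: (cid e) => x [].
by move=> l; rewrite lexx ler01.
Qed.

Lemma signature_representative x : cube01 x ->
  signature n N h (representative (signature n N h x)) = signature n N h x.
Proof.
move=> x01; rewrite /representative; case: pselect => [e|[]]; last by exists x.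
by case: (cid e) => y [].
Qed.

End Covering.

Theorem theorem1 (R : realType) (dT : measure_display) (T : measurableType dT)
    (P : probability T R) (d : nat) (eps : ('I_d -> int) -> T -> R)
    (g : ('I_d -> R) -> R) (K : ('I_d -> R) -> R) (h : nat -> R) (q : R) :
  (0 < d)%N ->
  (forall i, measurable_fun setT (eps i)) ->
  strictly_stationary P eps ->
  P.-integrable setT (EFin \o eps (@zzero d)) ->
  ('E_P[eps (@zzero d)] = 0)%E ->
  prob_density K ->
  assumptionA1 K ->
  (forall n, 0 < h n) ->
  h @ \oo --> 0 ->
  (fun n => n%:R * h n) @ \oo --> +oo ->
  0 < q < 2 ->
  condC2 P eps q ->
  O_as P (sup_dev P K g eps h)
    (fun n => (ln n%:R) `^ (q^-1) / (n%:R * h n) `^ (d%:R / 2)).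

Proof.
move=> d0 meps stat ieps E0 dK [_ K0 Ksupp [eta eta0 Klip] [c [C [c0 C0 Kb]]]] h0 h_cvg nh_cvg q02 C2.
have [C' C'0 HC] := condC2_moment_bound meps stat q02 C2.
have am := condC2_all_moments meps stat q02 C2.
have /andP[q0 q2] := q02.
have mean0 i : \int[P]_w (eps i w) = 0.
  rewrite (stationary_Rintegral meps stat (F := id))//.
  by move: E0; rewrite unlock /Rintegral => ->.
(* The exponent of [N] is d + 2 for the size of the errors, 1 for 1/h <= n and d for the target
   n^(-d). There are at most (5N)^(3d) cells, and [kap] cancels this power of n with 2 to spare for
   summability. *)
pose N n := (n ^ (2 * d + 3))%N; pose kap := ((2 * d + 3) * (3 * d) + 2)%N.
pose lam := threshold (d := d) c C C' q kap.
pose F1 n (s : signature_type n (N n)) := [set w | (lam * rate d n (h n) q <=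
  `|deviation eps K n (h n) (representative (h n) s) w|)%R].
(* Outside these events all errors are below n^(d+2), as the Lipschitz comparison requires; second
   moments over n^d points make their union summably rare. *)
pose F2 n (f : {ffun 'I_d -> 'I_n}) := [set w | (n%:R ^+ (d + 2) <= `|eps (gridix f) w|)%R].
pose F n := \bigcup_s F1 n s `|` \bigcup_f F2 n f.
have mnorm (X : T -> R) a : measurable_fun setT X -> measurable [set w | (a <= `|X w|)%R].
  move=> mX; have := measurable_fun_ler (measurable_cst a) (measurableT_comp (@normr_measurable R setT) mX).
  move=> /(_ measurableT [set true] I); rewrite setTI; congr measurable.
have mF1 n s : measurable (F1 n s) by apply: mnorm; case: (all_moments_deviation K am n (h n) (representative (h n) s)).
have mF2 n f : measurable (F2 n f) by exact: mnorm.
have mF n : measurable (F n).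
  by apply: measurableU; apply: fin_bigcup_measurable => //; exact: finite_finset.
have [n0 _ good] : \forall n \near \oo, [/\ 1 <= ln (n%:R : R), 1 <= n%:R * h n & h n <= 1].
  near=> n; split; near: n.
  - exists (Num.truncn (expR 1 : R)).+1 => // n /= en; rewrite -[leLHS](expRK 1) ler_ln ?posrE ?expR_gt0//.
      by rewrite ltW// (lt_le_trans (truncnS_gt _))// ler_nat.
    by rewrite ltr0n (leq_trans _ en).
  - by move/cvgryPge : nh_cvg; apply.
  - by apply: (cvgr_le _ h_cvg); exact: ltr01.
pose V := \int[P]_w (eps (@zzero d) w ^+ 1.*2).
have V0 : 0 <= V by apply: Rintegral_ge0 => w _; exact: exprn_double_ge0.
have PF n : (n0 <= n)%N -> (P (F n) <= ((5 ^+ (3 * d) + V) / n%:R ^+ 2)%:E)%E.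
  move=> /good[L1 nh1 h1].
  have n_gt0 : (0 < n)%N.
    by rewrite lt0n; apply/eqP => n0'; move: nh1; rewrite n0' mul0r ler10.
  have nR : (0 : R) < n%:R by rewrite ltr0n.
  have n1 : (1 : R) <= n%:R by rewrite ler1n.
  have P1 : (P (\bigcup_s F1 n s) <= (5 ^+ (3 * d) / n%:R ^+ 2)%:E)%E.
    apply: (le_trans (finType_union_le (B := (n%:R ^+ kap)^-1) (mF1 n) _)).
      by move=> s; apply: deviation_tail => //; exact: representative_cube.
    rewrite lee_fin card_signature_type natrX.
    have -> : (n%:R : R) ^+ kap = (N n)%:R ^+ (3 * d) * n%:R ^+ 2.
      by rewrite /kap /N natrX -exprM exprD.
    have NR : (0 : R) < (N n)%:R by rewrite natrX exprn_gt0.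
    rewrite invfM mulrA ler_wpM2r ?invr_ge0 ?exprn_ge0//.
    (* The 5 comes from 3n + N + 1 <= 5N, valid because 1 <= n <= N. *)
    rewrite -expr_div_n lerXn2r ?nnegrE ?divr_ge0 ?(ltW NR)// ler_pdivrMr//.
    have nN : (n <= N n)%N by rewrite /N -{1}(expn1 n) leq_pexp2l// addn_gt0 orbT.
    by rewrite -natrM ler_nat; move: (N n) n_gt0 nN => M; clear; lia.
  have P2 : (P (\bigcup_f F2 n f) <= (V / n%:R ^+ 2)%:E)%E.
    apply: (le_trans (finType_union_le (B := V / (n%:R ^+ (d + 2)) ^+ 2) (mF2 n) _)).
      move=> f; apply: (le_trans (markov_even_moment 0 (am (gridix f)) _)).
        by rewrite exprn_gt0.
      rewrite lee_fin /V (stationary_Rintegral meps stat (F := fun y => y ^+ 1.*2))//.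
    rewrite lee_fin card_ffun !card_ord natrX mulrCA ler_wpM2l//.
    have -> : (n%:R ^+ (d + 2)) ^+ 2 = n%:R ^+ 2 * n%:R ^+ (d + (d + 2)) :> R.
      by rewrite -exprM -exprD; congr (_ ^+ _); clear; lia.
    rewrite invfM mulrCA ler_piMr ?invr_ge0 ?exprn_ge0//.
    rewrite ler_pdivrMr; last by rewrite exprn_gt0.
    by rewrite mul1r ler_weXn2l// leq_addr.
  rewrite mulrDl EFinD; apply: le_trans (leeD P1 P2).
  by apply: measureU2; apply: fin_bigcup_measurable => //; exact: finite_finset.
have BC := borel_cantelli_inv_sqr mF PF.
pose lam2 := eta * (c^-1 + C / c ^+ 2).
have lam20 : 0 < lam2 by rewrite mulr_gt0// addr_gt0 ?invr_gt0// divr_gt0// exprn_gt0.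
have lam1 : 1 <= lam by exact: threshold_ge1.
exists (lam + lam2); first by rewrite addr_gt0// (lt_le_trans ltr01).
apply: filterS BC => w [n1 _ noF]; apply: limn_esup_le.
exists (maxn n0 n1) => // n /=; rewrite geq_max => /andP[/good[L1 nh1 h1] /noF nF].
rewrite -/(rate d n (h n) q).
have r0 : 0 < rate d n (h n) q by exact: rate_gt0.
have n_gt0 : (0 < n)%N.
  by rewrite lt0n; apply/eqP => n0'; move: nh1; rewrite n0' mul0r ler10.
have nR : (0 : R) < n%:R by rewrite ltr0n.
have N_gt0 : (0 < N n)%N by rewrite expn_gt0 n_gt0.
rewrite lee_pdivrMr//; apply: ge_ereal_sup => _ [x x01 <-].
rewrite (gn_centered K am)// -EFinM lee_fin.
set xs := representative (h n) (signature n (N n) (h n) x).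
have xs01 : xs \in @cube01 R d by exact: representative_cube.
have xin : x \in @cube01 R d by rewrite inE.
have [actE dist] := signatureP (h0 n) h1 n_gt0 N_gt0 xin xs01 (esym (signature_representative _ _ _ x01)).
have dev_xs : `|deviation eps K n (h n) xs w| <= lam * rate d n (h n) q.
  rewrite leNgt; apply/negP => lt; apply: nF; left.
  by exists (signature n (N n) (h n) x) => //; exact: ltW.
have eps_le (f : {ffun 'I_d -> 'I_n}) : `|eps (gridix f) w| <= n%:R ^+ (d + 2).
  rewrite leNgt; apply/negP => lt; apply: nF; right.
  by exists f => //; exact: ltW.
have card0 : (0 < #|active n (h n) x|)%N.
  rewrite -(ltr_nat R) (lt_le_trans _ (active_card_ge nh1 h1 (h0 n) xin))//.
  by rewrite exprn_gt0// divr_gt0// (lt_le_trans ltr01).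
have diff := sum_weight_diff K0 Ksupp eta0 Klip c0 Kb (h0 n) actE card0
  _ dist eps_le.
have {diff} := diff _; rewrite invr_ge0 ler0n => /(_ isT) diff.
(* By the choice of [N] the left side equals n^(-d) / (n h), at most n^(-d) since n h >= 1. *)
have Nh : (N n)%:R^-1 / h n * n%:R ^+ (d + 2) <= rate d n (h n) q.
  apply: le_trans (rate_ge d L1 nh1 h1 q0).
  have -> : (N n)%:R = n%:R ^+ (d + 2) * n%:R ^+ d * n%:R :> R.
    by rewrite /N natrX -exprD -exprSr; congr (_ ^+ _); clear; lia.
  have -> : (n%:R ^+ (d + 2) * n%:R ^+ d * n%:R)^-1 / h n * n%:R ^+ (d + 2) =
      (n%:R ^+ d)^-1 / (n%:R * h n).
    by field; rewrite !expf_neq0 ?gt_eqF.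
  by rewrite ler_piMr ?invr_ge0 ?exprn_ge0// invf_le1// (lt_le_trans ltr01).
rewrite -[X in `|X|](subrK (deviation eps K n (h n) xs w)) addrC mulrDl.
rewrite (le_trans (ler_normD _ _))// lerD// (le_trans diff)//.
rewrite (_ : _ * n%:R ^+ (d + 2) = lam2 * ((N n)%:R^-1 / h n * n%:R ^+ (d + 2))); last first.
  by rewrite /lam2; ring.
by rewrite ler_wpM2l// ltW.
Unshelve. all: by end_near. Qed.
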